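(* For $\theta\in(0,\pi/2]$ let $X^\theta$ be a mean zero Gaussian vector in $\mathbb{R}^4$ with covariance matrix $$A=\begin{pmatrix} 1&\cos^2\theta&\cos^2\theta-\sin^2\theta&\cos^2\theta\\ \cos^2\theta&1&\cos^2\theta&\cos^2\theta-\sin^2\theta\\ \cos^2\theta-\sin^2\theta&\cos^2\theta&1&\cos^2\theta\\ \cos^2\theta&\cos^2\theta-\sin^2\theta&\cos^2\theta&1 \end{pmatrix},$$ and let $X^{\theta,h}$ denote its threshold process at level $h$. Then (i) $X^{\theta,0}$ is a color process for all $\theta\in(0,\pi/4]$; (ii) there is $\theta_0>0$ such that for all $\theta\in(0,\theta_0)$ there exists $h_\theta>0$ such that $X^{\theta,h}$ is a color process for all $h\in(0,h_\theta)$; (iii) for all $\theta\in(0,\pi/4)$ there is $h_\theta>0$ such that $X^{\theta,h}$ has no color representation for any $h>h_\theta$.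
   Context: A $\{0,1\}$-valued process $(Y_i)_{i\in S}$ is a color process (equivalently, has a color representation) if there are $p\in[0,1]$ and a random partition $\pi$ of $S$ such that $(Y_i)$ has the same law as the process obtained by sampling $\pi$ and then, independently of $\pi$ and independently for different partition elements, assigning all elements of a partition element the value $1$ with probability $p$ and the value $0$ with probability $1-p$. For a random vector $X^\theta=(X^\theta_1,\dots,X^\theta_4)$ and $h\in\mathbb{R}$, $X^{\theta,h}=(I(X^\theta_i>h))_{1\le i\le 4}$. *)

(* Defs.v *)
From HB Require Import structures.
From mathcomp Require Import all_boot all_order all_algebra.
From mathcomp Require Import all_classical all_reals all_analysis.
Set Implicit Arguments.
Unset Strict Implicit.
Unset Printing Implicit Defensive.
Import Order.TTheory GRing.Theory Num.Theory.
Import numFieldNormedType.Exports.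
Local Open Scope classical_set_scope.
Local Open Scope ring_scope.

(* [s] is the standard deviation. The case [s = 0] is treated apart because
   the library's [normal_prob m 0] is not the point mass at [m]. *)
Definition gaussian_law (R : realType) (m s : R) : set R -> \bar R :=
  if s == 0 then dirac m else normal_prob m s.

Definition is_gaussian (R : realType) (d : measure_display)
    (T : measurableType d) (P : probability T R) (Z : T -> R) : Prop :=
  exists m s : R, 0 <= s /\
    forall B : set R, measurable B -> P (Z @^-1` B) = gaussian_law m s B.

(* Joint Gaussianity via linear combinations, so that singular covariance
   matrices are allowed. *)
Definition centered_gaussian_vector (R : realType) (d : measure_display)
    (T : measurableType d) (P : probability T R) (n : nat)
    (X : 'I_n -> {RV P >-> R}) (A : 'M[R]_n) : Prop :=
  [/\ forall a : 'I_n -> R, is_gaussian P (fun w => \sum_(i < n) a i * X i w),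
      forall i, ('E_P[X i] = 0)%E
    & forall i j, covariance P (X i) (X j) = (A i j)%:E].

Definition threshold (R : realType) (d : measure_display)
    (T : measurableType d) (P : probability T R) (S : Type)
    (X : S -> {RV P >-> R}) (h : R) : S -> T -> bool :=
  fun i w => h < X i w.

(* A random partition of the finite set [S], given by its probability mass
   function. *)
Definition random_partition (R : realType) (S : finType)
    (q : {set {set S}} -> R) : Prop :=
  [/\ forall pi, 0 <= q pi,
      forall pi, ~~ finset.partition pi [set: S]%SET -> q pi = 0
    & \sum_pi q pi = 1].

(* Probability that the colored process equals [y]: sample [pi] from [q], then
   color the blocks of [pi] by independent Bernoulli([p]) variables. A coloring
   of the blocks of [pi] is encoded as a function [c] on all subsets of [S]
   that takes the dummy value [false] on non-blocks. *)
Definition color_pmf (R : realType) (S : finType) (p : R)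
    (q : {set {set S}} -> R) (y : {ffun S -> bool}) : R :=
  \sum_pi q pi *
    \sum_(c : {ffun {set S} -> bool} | (c \in pffun_on false (mem pi) predT)
                         && [forall i, c (finset.pblock pi i) == y i])
      \prod_(B in pi) bernoulli_pmf p (c B).

Definition color_process (R : realType) (d : measure_display)
    (T : measurableType d) (P : probability T R) (S : finType)
    (Y : S -> T -> bool) : Prop :=
  exists (p : R) (q : {set {set S}} -> R),
    [/\ 0 <= p <= 1, random_partition q
      & forall y : {ffun S -> bool},
          P [set w | forall i, Y i w = y i] = (color_pmf p q y)%:E].

Definition covA (R : realType) (theta : R) : 'M[R]_4 :=
  \matrix_(i, j)
    if i == j then 1
    else if odd (i + j) then cos theta ^+ 2
    else cos theta ^+ 2 - sin theta ^+ 2.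

(* Main.v *)
(* Write s = sin theta and c = cos theta. The covariance is that of
     h + s (U + V1), h + s (U + V2), h + s (U - V1), h + s (U - V2)
   with U ~ N(- h / s, (c / s)^2) and V1, V2 standard normal, all independent.
   So, given U = u, the pattern of the signs of (U + V1, U - V1) and that of
   (U + V2, U - V2) are independent, and with k the standard normal tail the
   patterns 1110, 1000, 1100 have probabilities
     n3 = E[1_{U > 0} (1 - 2 k|U|) k|U|],  n1 = E[1_{U <= 0} (1 - 2 k|U|) k|U|],
     n2 = E[(k|U|)^2],
   while 1010 has probability 0 and the law is invariant under rotation. The two
   Gaussian vectors have the same threshold laws since trigonometric polynomials
   form an algebra, from which indicators of orthants are bounded limits.

   A rotation invariant mixture of partitions with weights a (one block), b (two
   pairs of neighbours), c (3+1), e (2+1+1, neighbours together) matches these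
   probabilities iff n3 = p(1-p)(c + 2ep), n1 = p(1-p)(c + 2e(1-p)) and
   n2 = p(1-p)(b + e). For h = 0 one has n1 = n3, and nonnegativity of the
   solution is n3 <= n2 and n2 + n3 <= 1/8; the former comes from
   k(2u) <= 2 k(u)^2, the latter from E[k|U|] <= 1/4. For small theta and h,
   n1 - n3 = O(h s^2) is dominated by (1 - 2p) n3, which is at least of order h s.

   Conversely, any color process with no pattern 1010, whatever the partition,
   satisfies 4 (n1 - n3) <= 2p; for large h adjacent coordinates rarely exceed h
   simultaneously, so that n1 ~ p and n3 = o(p). *)

Require Import Defs.
From HB Require Import structures.
From mathcomp Require Import all_boot all_order all_algebra.
From mathcomp Require Import all_classical all_reals all_analysis.
From mathcomp Require Import measurable_realfun ring lra.
Set Implicit Arguments.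
Unset Strict Implicit.
Unset Printing Implicit Defensive.
Import Order.TTheory GRing.Theory Num.Theory.
Import numFieldNormedType.Exports.
Local Open Scope classical_set_scope.
Local Open Scope ring_scope.

(** * Color processes on the 4-cycle *)

(** The covariance has rank three: X0 + X2 = X1 + X3 almost surely. This is why 1010 has probability
    0, and also why [X] has no density, so that its threshold patterns are identified through
    expectations of trigonometric polynomials. Cosines with an arbitrary phase are enough for that,
    and everything stays real-valued. Since total mass and marginals match automatically, only the
    three equations for n1, n2, n3 constrain the weights b, c, e. For p different from 1/2 they
    force e = (n1 - n3) / (2p(1-p)(1-2p)), whose numerator and denominator both vanish with h. This
    is the obstacle in (ii): n1 - n3 has to be compared with (1 - 2p) n3 by explicit bounds, not by
    continuity at h = 0. At h = 0 itself the system is degenerate and leaves one parameter free. *)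

(* A partition is encoded by the idempotent map [r] sending a point to the
   representative of its block. *)
Definition coloring_weight (R : realType) (S : finType) (p : R) (r : S -> S)
    (y : {ffun S -> bool}) : R :=
  if [forall i, y (r i) == y i] then \prod_(i | r i == i) bernoulli_pmf p (y i)
  else 0.

Definition block_repr (S : finType) (pi : {set {set S}}) (r : S -> S) : Prop :=
  (forall i, r i \in finset.pblock pi i) /\
  (forall i j, j \in finset.pblock pi i -> r j = r i).

(** At most one coloring of the blocks induces [y], and one exists iff [y] is constant on blocks.
    The sum thus has at most one term, whose blocks are reindexed by their representatives. *)
Lemma coloring_weightE (R : realType) (S : finType) (p : R)
    (pi : {set {set S}}) (r : S -> S) (y : {ffun S -> bool}) :
  finset.partition pi [set: S]%SET -> block_repr pi r ->
  \sum_(c : {ffun {set S} -> bool} | (c \in pffun_on false (mem pi) predT)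
                         && [forall i, c (finset.pblock pi i) == y i])
      \prod_(B in pi) bernoulli_pmf p (c B) = coloring_weight p r y.
Proof.
move=> /and3P[/eqP covS tI pi0] [r1 r2].
have cov i : i \in finset.cover pi by rewrite covS inE.
have rr i : r (r i) = r i by apply: r2.
have blk i : finset.pblock pi (r i) = finset.pblock pi i.
  by apply: same_pblock.
rewrite /coloring_weight; case: ifPn => [/forallP yr|/forallPn[i yri]]; last first.
  rewrite big_pred0// => c; apply/negbTE/negP => /andP[_ /forallP cy].
  move/negP: yri; apply.
  by rewrite -(eqP (cy i)) -(eqP (cy (r i))) blk.
(* As [y] is constant on blocks, any element of a block tells its color; the conjunct [B \in pi]
   produces the dummy value [false] elsewhere. *)
pose c0 := [ffun B : {set S} => (B \in pi) && [exists i in B, y i]].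
have c0E i : c0 (finset.pblock pi i) = y i.
  rewrite ffunE pblock_mem//=; apply/existsP/idP => [[j /andP[ji yj]]|yi].
    by rewrite -(eqP (yr i)) -(r2 _ _ ji) (eqP (yr j)).
  by exists i; rewrite mem_pblock cov.
rewrite (big_pred1 c0); last first.
  move=> c; apply/andP/eqP => [[/pffun_onP[/fintype.subsetP c1 _] /forallP c2]|->].
    apply/ffunP => B; have [Bpi|Bpi] := boolP (B \in pi).
      have /set0Pn[x xB] : B != finset.set0 by apply: contraNneq pi0 => <-.
      by rewrite -(def_pblock tI Bpi xB) c0E (eqP (c2 x)).
    rewrite ffunE (negbTE Bpi) /=; apply/eqP; apply: contraNT Bpi => cB.
    by apply: (c1 B); rewrite inE cB.
  split; last by apply/forallP => i; rewrite c0E.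
  apply/pffun_onP; split; last by [].
  apply/fintype.subsetP => B; rewrite inE ffunE.
  by case: (B \in pi).
have -> : pi = [set finset.pblock pi i | i in [set i | r i == i]%SET]%SET.
  apply/setP => B; apply/idP/imsetP => [Bpi|[i _ ->]]; last by rewrite pblock_mem.
  have /set0Pn[x xB] : B != finset.set0 by apply: contraNneq pi0 => <-.
  exists (r x); first by rewrite inE rr.
  by rewrite blk (def_pblock tI Bpi xB).
rewrite big_imset/=; last first.
  move=> i j; rewrite !inE => /eqP ri /eqP rj ij.
  by rewrite -ri -rj; apply: r2; rewrite -ij mem_pblock.
rewrite (eq_bigl (fun i => r i == i)); last by move=> i; rewrite inE.
by apply: eq_bigr => i _; rewrite c0E.
Qed.

(** Lets a random partition be given by an explicit weighted list of idempotent maps, each standing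
    for the partition into its fibres, so that pattern probabilities can be evaluated by
    computation. Entries with the same fibres simply add up. *)
Lemma color_pmf_mixture (R : realType) (S : finType) (L : seq (R * (S -> S))) :
  (forall x, List.In x L -> 0 <= x.1 /\ (forall i, x.2 (x.2 i) = x.2 i)) ->
  \sum_(x <- L) x.1 = 1 ->
  exists q : {set {set S}} -> R, random_partition q /\
    forall p y, color_pmf p q y = \sum_(x <- L) x.1 * coloring_weight p x.2 y.
Proof.
move=> HL sL.
pose part (r : S -> S) := preim_partition r [set: S]%SET.
exists (fun pi => \sum_(x <- L) x.1 * (part x.2 == pi)%:R); split.
  split.
  - move=> pi; elim: L HL {sL} => [|x L IH] HL; first by rewrite big_nil.
    rewrite big_cons addr_ge0//; last by apply: IH => z zL; apply: HL; right.
    by rewrite mulr_ge0 ?ler0n//; apply: (HL _ _).1; left.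
  - move=> pi npi; rewrite big1// => x _.
    case: eqP => [e|_]; last by rewrite mulr0.
    by move: npi; rewrite -e preim_partitionP.
  - rewrite exchange_big/= -[RHS]sL; apply: eq_bigr => x _.
    rewrite -mulr_sumr (bigD1 (part x.2))//= eqxx big1 ?addr0 ?mulr1// => pi.
    by rewrite eq_sym => /negbTE ->.
move=> p y; rewrite /color_pmf.
under eq_bigr do rewrite mulr_suml.
rewrite exchange_big/=.
elim: L HL {sL} => [|x L IH] HL; first by rewrite !big_nil.
rewrite !big_cons IH; last by move=> z zL; apply: HL; right.
congr (_ + _).
rewrite (bigD1 (part x.2))//= eqxx mulr1 [X in _ + X]big1 ?addr0; last first.
  by move=> pi; rewrite eq_sym => /negbTE ->; rewrite mulr0 mul0r.
congr (_ * _); apply: coloring_weightE; first exact: preim_partitionP.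
have pE i j : (j \in finset.pblock (part x.2) i) = (x.2 i == x.2 j).
  by rewrite /part /preim_partition pblock_equivalence_partition ?inE//=;
    move=> a b c _ _ _; split=> // /eqP->.
have [_ idx] := HL x (or_introl erefl).
split=> [i|i j]; first by rewrite pE idx.
by rewrite pE => /eqP.
Qed.

Definition o0 : 'I_4 := @Ordinal 4 0 isT.
Definition o1 : 'I_4 := @Ordinal 4 1 isT.
Definition o2 : 'I_4 := @Ordinal 4 2 isT.
Definition o3 : 'I_4 := @Ordinal 4 3 isT.

Lemma ord4P (Q : 'I_4 -> Prop) : Q o0 -> Q o1 -> Q o2 -> Q o3 -> forall i, Q i.
Proof.
move=> q0 q1 q2 q3 [[|[|[|[|k]]]] ik] //.
- by rewrite (_ : Ordinal ik = o0)//; apply: val_inj.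
- by rewrite (_ : Ordinal ik = o1)//; apply: val_inj.
- by rewrite (_ : Ordinal ik = o2)//; apply: val_inj.
- by rewrite (_ : Ordinal ik = o3)//; apply: val_inj.
Qed.

Lemma forall_ord4 (Q : pred 'I_4) :
  [forall i, Q i] = [&& Q o0, Q o1, Q o2 & Q o3].
Proof.
apply/forallP/and4P => [H|[q0 q1 q2 q3]]; first by split.
exact: (ord4P (Q := Q)).
Qed.

Lemma big_ord4 (T : Type) (idx : T) (op : Monoid.com_law idx) (F : 'I_4 -> T) :
  \big[op/idx]_i F i = op (F o0) (op (F o1) (op (F o2) (F o3))).
Proof.
rewrite !big_ord_recl big_ord0 Monoid.mulm1.
by congr (op _ (op _ (op _ _))); congr F; apply: val_inj.
Qed.

Definition pat (b0 b1 b2 b3 : bool) : {ffun 'I_4 -> bool} :=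
  [ffun i => nth false [:: b0; b1; b2; b3] (i : 'I_4)].

Lemma patE (y : {ffun 'I_4 -> bool}) : y = pat (y o0) (y o1) (y o2) (y o3).
Proof. by apply/ffunP; apply: ord4P; rewrite ffunE. Qed.

Definition repr4 (a b c d : 'I_4) (i : 'I_4) : 'I_4 := nth i [:: a; b; c; d] i.

Lemma repr4E (r : 'I_4 -> 'I_4) : r = repr4 (r o0) (r o1) (r o2) (r o3).
Proof. by apply/funext; apply: ord4P. Qed.

Lemma coloring_weight4 (R : realType) (p : R) (a b c d : 'I_4) (y0 y1 y2 y3 : bool) :
  let s := [:: y0; y1; y2; y3] in let B := @bernoulli_pmf R p in
  coloring_weight p (repr4 a b c d) (pat y0 y1 y2 y3) =
  if [&& nth false s a == y0, nth false s b == y1, nth false s c == y2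
       & nth false s d == y3]
  then (if a == o0 then B y0 else 1) * ((if b == o1 then B y1 else 1) *
       ((if c == o2 then B y2 else 1) * (if d == o3 then B y3 else 1)))
  else 0.
Proof.
move=> s B; rewrite /coloring_weight forall_ord4 big_mkcond big_ord4.
by rewrite !ffunE.
Qed.

(** Exactly the eleven of the fifteen partitions that put some two neighbours in one block, that is,
    those under which 1010 is impossible; the weights are constant on rotation orbits. *)
Definition cyclic_mixture (R : realType) (a b c e : R) : seq (R * ('I_4 -> 'I_4)) :=
  [:: (a, repr4 o0 o0 o0 o0);
      (b, repr4 o0 o0 o2 o2); (b, repr4 o0 o1 o1 o0);
      (c, repr4 o0 o0 o0 o3); (c, repr4 o0 o0 o2 o0);
      (c, repr4 o0 o1 o0 o0); (c, repr4 o0 o1 o1 o1);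
      (e, repr4 o0 o0 o2 o3); (e, repr4 o0 o1 o1 o3);
      (e, repr4 o0 o1 o2 o2); (e, repr4 o0 o1 o2 o0)].

Definition rotation_invariant (R : realType) (nu : {ffun 'I_4 -> bool} -> R) : Prop :=
  forall b0 b1 b2 b3, nu (pat b0 b1 b2 b3) = nu (pat b3 b0 b1 b2).

(** The sixteen patterns form six rotation orbits. With the orbit of 1010 null, five numbers
    determine [nu]. *)
Lemma rotation_invariantE (R : realType) (nu : {ffun 'I_4 -> bool} -> R) :
  rotation_invariant nu -> nu (pat true false true false) = 0 ->
  forall b0 b1 b2 b3, nu (pat b0 b1 b2 b3) =
  match b0, b1, b2, b3 with
  | false, false, false, false => nu (pat false false false false)
  | true, true, true, true => nu (pat true true true true)
  | true, false, true, false | false, true, false, true => 0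
  | true, true, false, false | false, true, true, false
  | false, false, true, true | true, false, false, true =>
      nu (pat true true false false)
  | true, false, false, false | false, true, false, false
  | false, false, true, false | false, false, false, true =>
      nu (pat true false false false)
  | true, true, true, false | false, true, true, true
  | true, false, true, true | true, true, false, true =>
      nu (pat true true true false) end.
Proof.
move=> rot nu0; do 4 case => //; rewrite -?nu0; repeat (try reflexivity; rewrite rot).
Qed.

Lemma cyclic_color_process (R : realType) (nu : {ffun 'I_4 -> bool} -> R)
    (p a b c e : R) (n0 := nu (pat false false false false))
    (n1 := nu (pat true false false false)) (n2 := nu (pat true true false false))
    (n3 := nu (pat true true true false)) (n4 := nu (pat true true true true)) :
  rotation_invariant nu -> nu (pat true false true false) = 0 ->
  n4 + 3 * n3 + 2 * n2 + n1 = p -> n0 + 4 * n1 + 4 * n2 + 4 * n3 + n4 = 1 ->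
  0 <= a -> 0 <= b -> 0 <= c -> 0 <= e -> a + 2 * b + 4 * c + 4 * e = 1 ->
  n3 = p * (1 - p) * (c + 2 * e * p) ->
  n1 = p * (1 - p) * (c + 2 * e * (1 - p)) ->
  n2 = p * (1 - p) * (b + e) ->
  exists q : {set {set 'I_4}} -> R, random_partition q /\
    forall y, color_pmf p q y = nu y.
Proof.
move=> rot nu1010 Hp Ht a0 b0 c0 e0 Hs H3 H1 H2.
have mixE x : List.In x (cyclic_mixture a b c e) ->
    0 <= x.1 /\ (forall i, x.2 (x.2 i) = x.2 i).
  by move=> /= H; repeat (case: H => [<-|H]; first by split => //; apply: ord4P).
have mix1 : \sum_(x <- cyclic_mixture a b c e) x.1 = 1.
  by rewrite /cyclic_mixture !big_cons big_nil /=; lra.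
have [q [rq Hq]] := color_pmf_mixture mixE mix1.
exists q; split=> // y; rewrite Hq.
have H4 : n4 = p - 3 * n3 - 2 * n2 - n1 by lra.
have H0 : n0 = 1 - 4 * n1 - 4 * n2 - 4 * n3 - n4 by lra.
have Ea : a = 1 - 2 * b - 4 * c - 4 * e by lra.
rewrite [X in _ = nu X](patE y) (rotation_invariantE rot nu1010) -/n0 -/n1 -/n2 -/n3 -/n4.
rewrite (patE y) /cyclic_mixture !big_cons big_nil /= !coloring_weight4 !ffunE/= /bernoulli_pmf.
case: (y o0); case: (y o1); case: (y o2); case: (y o3) => /=;
  rewrite ?H0 ?H4 ?H1 ?H2 ?H3 ?Ea; ring.
Qed.

(** The representative is the least element of the block. On four points, [r i <= i] together with
    idempotence leaves exactly fifteen maps, one for each partition, and the case analyses below run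
    through these. *)
Lemma partition_block_repr n (pi : {set {set 'I_n}}) :
  finset.partition pi [set: 'I_n]%SET ->
  exists r : 'I_n -> 'I_n, [/\ block_repr pi r, forall i, (r i <= i)%N
    & forall i, r (r i) = r i].
Proof.
move=> /and3P[/eqP covS tI pi0].
have memi i : i \in finset.pblock pi i by rewrite mem_pblock covS inE.
pose r i := [arg min_(j < i in finset.pblock pi i) (j : nat)]%N.
have r1 i : r i \in finset.pblock pi i by rewrite /r; case: arg_minnP.
have r2 i : (r i <= i)%N by rewrite /r; case: arg_minnP => // j _; apply.
have r3 i j : j \in finset.pblock pi i -> r j = r i.
  move=> ji; have e : finset.pblock pi j = finset.pblock pi i by apply: same_pblock.
  rewrite /r; case: arg_minnP => // k; rewrite e => ki kmin.
  case: arg_minnP => // l li lmin; apply/val_inj/eqP.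
  by rewrite eqn_leq kmin ?lmin.
by exists r; split=> // i; exact: r3.
Qed.

(** The expected number of ones under the mass function [F]; it recovers [p] from a color
    process. *)
Definition weighted_ones (R : realType) (F : {ffun 'I_4 -> bool} -> R) : R :=
  4 * F (pat true true true true)
  + 3 * (F (pat false true true true) + F (pat true false true true)
         + F (pat true true false true) + F (pat true true true false))
  + 2 * (F (pat true true false false) + F (pat false true true false)
         + F (pat false false true true) + F (pat true false false true)
         + F (pat true false true false) + F (pat false true false true))
  + (F (pat true false false false) + F (pat false true false false)
         + F (pat false false true false) + F (pat false false false true)).

(** P(exactly one 1) - P(exactly three 1s). Being linear in [F], it can be bounded partition by
    partition. *)
Definition odd_imbalance (R : realType) (F : {ffun 'I_4 -> bool} -> R) : R :=
  (F (pat true false false false) + F (pat false true false false)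
         + F (pat false false true false) + F (pat false false false true))
  - (F (pat false true true true) + F (pat true false true true)
         + F (pat true true false true) + F (pat true true true false)).

Lemma weighted_ones_sum (R : realType) (I : finType) (q : I -> R)
    (F : I -> {ffun 'I_4 -> bool} -> R) :
  weighted_ones (fun y => \sum_i q i * F i y) = \sum_i q i * weighted_ones (F i).
Proof.
rewrite /weighted_ones -!big_split/= !mulr_sumr -!big_split/=.
by apply: eq_bigr => i _; ring.
Qed.

Lemma odd_imbalance_sum (R : realType) (I : finType) (q : I -> R)
    (F : I -> {ffun 'I_4 -> bool} -> R) :
  odd_imbalance (fun y => \sum_i q i * F i y) = \sum_i q i * odd_imbalance (F i).
Proof.
rewrite /odd_imbalance -!big_split/= -sumrB.
by apply: eq_bigr => i _; ring.
Qed.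

Lemma coloring_weight_ones (R : realType) (p : R) (r : 'I_4 -> 'I_4) :
  (forall i, (r i <= i)%N) -> (forall i, r (r i) = r i) ->
  weighted_ones (coloring_weight p r) = 4 * p.
Proof.
move=> rle rr; rewrite (repr4E r).
have := rr o0; have := rr o1; have := rr o2; have := rr o3.
have := rle o0; have := rle o1; have := rle o2; have := rle o3.
rewrite [r]repr4E; move: (r o0) (r o1) (r o2) (r o3).
do 4 (apply: ord4P => //); move=> _ _ _ _;
  do 4! [move=> /(congr1 val)/= H; try discriminate H; clear H];
  rewrite /weighted_ones !coloring_weight4/= /bernoulli_pmf; ring.
Qed.

(** The condition on 1010 rules out the four partitions without two neighbours in a block; four
    singletons would give 4p(1-p)(1-2p). Of the other eleven, those of type 2+1+1 give 2p(1-p)(1-2p)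
    and the rest give 0. *)
Lemma coloring_weight_imbalance (R : realType) (p : R) (r : 'I_4 -> 'I_4) :
  (forall i, (r i <= i)%N) -> (forall i, r (r i) = r i) -> 0 < p < 1 ->
  coloring_weight p r (pat true false true false) = 0 ->
  odd_imbalance (coloring_weight p r) <= 2 * p.
Proof.
move=> rle rr /andP[p0 p1]; rewrite (repr4E r).
have q0 : 0 < 1 - p by lra.
have := rr o0; have := rr o1; have := rr o2; have := rr o3.
have := rle o0; have := rle o1; have := rle o2; have := rle o3.
rewrite [r]repr4E; move: (r o0) (r o1) (r o2) (r o3).
do 4 (apply: ord4P => //); move=> _ _ _ _;
  do 4! [move=> /(congr1 val)/= H; try discriminate H; clear H];
  rewrite /odd_imbalance !coloring_weight4/= /bernoulli_pmf ?mul1r ?mulr1 => /eqP;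
  rewrite ?mulf_eq0 ?(gt_eqF p0) ?(gt_eqF q0) //= => _; nra.
Qed.

(** The probability of 1010 is a sum of nonnegative terms, so if it vanishes, every partition of
    positive weight excludes 1010. The bounds for single partitions then average. *)
Lemma color_pmf_obstruction (R : realType) (p : R)
    (q : {set {set 'I_4}} -> R) (nu := color_pmf p q) :
  random_partition q -> weighted_ones nu = 4 * p /\
  (0 < p < 1 -> nu (pat true false true false) = 0 -> odd_imbalance nu <= 2 * p).
Proof.
move=> [q0 qpart qsum].
have /choice[r Hr] : forall pi : {set {set 'I_4}}, exists r : 'I_4 -> 'I_4,
    finset.partition pi [set: 'I_4]%SET ->
    [/\ block_repr pi r, forall i, (r i <= i)%N & forall i, r (r i) = r i].
  move=> pi; have [Hpi|_] := boolP (finset.partition pi [set: 'I_4]%SET).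
    by have [r ?] := partition_block_repr Hpi; exists r.
  by exists id.
have nuE : nu = fun y => \sum_pi q pi * coloring_weight p (r pi) y.
  apply/funext => y; apply: eq_bigr => pi _.
  have [Hpi|/qpart->] := boolP (finset.partition pi [set: 'I_4]%SET).
    by have [Hb _ _] := Hr _ Hpi; rewrite (coloring_weightE _ _ Hpi Hb).
  by rewrite !mul0r.
split=> [|p01].
  have -> : 4 * p = \sum_pi q pi * (4 * p) by rewrite -mulr_suml qsum mul1r.
  rewrite nuE weighted_ones_sum.
  apply: eq_bigr => pi _.
  have [Hpi|/qpart->] := boolP (finset.partition pi [set: 'I_4]%SET).
    by have [_ ? ?] := Hr _ Hpi; rewrite coloring_weight_ones.
  by rewrite !mul0r.
have W0 pi : 0 <= coloring_weight p (r pi) (pat true false true false).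
  rewrite /coloring_weight; case: ifP => // _; apply: prodr_ge0 => i _.
  by apply: bernoulli_pmf_ge0; case/andP: p01 => /ltW-> /ltW->.
rewrite nuE => /eqP; rewrite psumr_eq0; last by move=> pi _; rewrite mulr_ge0.
move=> /allP H; rewrite odd_imbalance_sum.
have -> : 2 * p = \sum_pi q pi * (2 * p) by rewrite -mulr_suml qsum mul1r.
apply: ler_sum => pi _.
have := H pi; rewrite mem_index_enum /= mulf_eq0 => /(_ isT)/orP[/eqP->|/eqP Wpi].
  by rewrite !mul0r.
have [Hpi|/qpart->] := boolP (finset.partition pi [set: 'I_4]%SET).
  by have [_ ? ?] := Hr _ Hpi; rewrite ler_wpM2l// coloring_weight_imbalance.
by rewrite !mul0r.
Qed.

(** * Threshold patterns and characteristic functions *)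

Lemma bounded_integrable (R : realType) (d : measure_display) (T : measurableType d)
    (P : probability T R) (F : T -> R) (M : R) :
  measurable_fun setT F -> (forall x, `|F x| <= M) -> P.-integrable setT (EFin \o F).
Proof.
move=> mF FM; apply: measurable_bounded_integrable => //.
  by rewrite (le_lt_trans (probability_le1 _ _)) ?ltry.
exists M; split; first exact: num_real.
by move=> x Mx y _; apply: le_trans (FM y) _; exact: ltW.
Qed.

Lemma bounded_cvg_Rintegral (R : realType) (d : measure_display)
    (T : measurableType d) (P : probability T R) (F_ : nat -> T -> R) (F : T -> R) (M : R) :
  (forall k, measurable_fun setT (F_ k)) -> (forall k x, `|F_ k x| <= M) ->
  (forall x, F_ ^~ x @ \oo --> F x) ->
  (\int[P]_x F_ k x) @[k --> \oo] --> \int[P]_x F x.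
Proof.
move=> mF FM cF.
have mlim : measurable_fun setT F.
  by apply: (@measurable_fun_cvg _ _ _ _ F_) => // x _; exact: cF.
have FM' x : `|F x| <= M.
  have c : `|F_ k x| @[k --> \oo] --> `|F x| by apply: cvg_norm; exact: cF.
  rewrite -(cvg_lim _ c)//; apply: limr_le; first by apply/cvg_ex; eexists; exact: c.
  by apply: nearW => k; exact: FM.
have iF := bounded_integrable P mlim FM'.
apply: fine_cvg; rewrite fineK; last exact: integrable_fin_num.
apply: (@dominated_cvg _ _ _ P setT measurableT (fun k x => (F_ k x)%:E) _ (cst M%:E)) => //.
- by move=> k; apply/measurable_EFinP.
- by move=> x _; apply: cvg_EFin; [exact: nearW|exact: cF].
- by apply: (bounded_integrable P (M := `|M|)) => //; exact: measurable_cst.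
- by move=> k x _; rewrite lee_fin.
Qed.

(** The linear span of cosines of affine forms. The phase [b] brings in sines and constants without
    complex exponentials. *)
Inductive trig_poly (R : realType) (n : nat) : (('I_n -> R) -> R) -> Prop :=
| trig_cos a b : trig_poly (fun x => cos (\sum_(i < n) a i * x i + b))
| trig_lin k F G : trig_poly F -> trig_poly G -> trig_poly (fun x => k * F x + G x).

Lemma trig_ext (R : realType) (n : nat) (F G : ('I_n -> R) -> R) :
  F =1 G -> trig_poly F -> trig_poly G.
Proof. by move/funext => ->. Qed.

Lemma trig_cst (R : realType) (n : nat) (k : R) : trig_poly (fun _ : 'I_n -> R => k).
Proof.
have one := trig_cos (fun _ : 'I_n => 0) (0 : R).
apply: (trig_ext _ (trig_lin (k - 1) one one)) => x.
rewrite big1; last by move=> i _; rewrite mul0r.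
by rewrite addr0 cos0; ring.
Qed.

Lemma trig_scale (R : realType) (n : nat) (k : R) (F : ('I_n -> R) -> R) :
  trig_poly F -> trig_poly (fun x => k * F x).
Proof.
by move=> tF; apply: (trig_ext _ (trig_lin k tF (trig_cst _ 0))) => x; rewrite addr0.
Qed.

Lemma trig_add (R : realType) (n : nat) (F G : ('I_n -> R) -> R) :
  trig_poly F -> trig_poly G -> trig_poly (fun x => F x + G x).
Proof.
by move=> tF tG; apply: (trig_ext _ (trig_lin 1 tF tG)) => x; rewrite mul1r.
Qed.

(** Bilinearity reduces this to cos A cos B = (cos(A + B) + cos(A - B)) / 2. *)
Lemma trig_mul (R : realType) (n : nat) (F G : ('I_n -> R) -> R) :
  trig_poly F -> trig_poly G -> trig_poly (fun x => F x * G x).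
Proof.
move=> tF tG; elim: tF => [a b|k F1 F2 _ IH1 _ IH2]; last first.
  by apply: (trig_ext _ (trig_lin k IH1 IH2)) => x; ring.
elim: tG => [a' b'|k G1 G2 _ IH1 _ IH2]; last first.
  by apply: (trig_ext _ (trig_lin k IH1 IH2)) => x; ring.
have t1 := trig_cos (fun i : 'I_n => a i + a' i) (b + b').
have t2 := trig_cos (fun i : 'I_n => a i - a' i) (b - b').
apply: (trig_ext _ (trig_add (trig_scale 2^-1 t1) (trig_scale 2^-1 t2))) => x.
under eq_bigr do rewrite mulrDl.
under [X in cos (X + (b - b'))]eq_bigr do rewrite mulrDl mulNr.
rewrite !big_split/= sumrN.
set A := \sum_i _; set B := \sum_i _.
rewrite (_ : A + B + (b + b') = (A + b) + (B + b')); last by ring.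
rewrite (_ : A - B + (b - b') = (A + b) - (B + b')); last by ring.
by rewrite cosD cosB; field.
Qed.

Lemma trig_prod (R : realType) (n : nat) (I : Type) (s : seq I)
    (F : I -> ('I_n -> R) -> R) :
  (forall i, trig_poly (F i)) -> trig_poly (fun x => \prod_(i <- s) F i x).
Proof.
move=> tF; elim: s => [|i s IH].
  by apply: (trig_ext _ (trig_cst _ 1)) => x; rewrite big_nil.
by apply: (trig_ext _ (trig_mul (tF i) IH)) => x; rewrite big_cons.
Qed.

Lemma trig_bounded (R : realType) (n : nat) (F : ('I_n -> R) -> R) :
  trig_poly F -> exists M, forall x, `|F x| <= M.
Proof.
elim=> [a b|k {}F G _ [M FM] _ [N GN]]; first by exists 1 => x; exact: cos_max.
exists (`|k| * M + N) => x.
by rewrite (le_trans (ler_normD _ _))// lerD// normrM ler_wpM2l.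
Qed.

Lemma measurable_cos (R : realType) : measurable_fun setT (@cos R).
Proof. by apply: continuous_measurable_fun; exact: continuous_cos. Qed.

Lemma trig_measurable (R : realType) (d : measure_display) (T : measurableType d)
    (n : nat) (X : 'I_n -> T -> R) (F : ('I_n -> R) -> R) :
  (forall i, measurable_fun setT (X i)) -> trig_poly F ->
  measurable_fun setT (fun w => F (X ^~ w)).
Proof.
move=> mX; elim=> [a b|k {}F G _ mF _ mG].
  apply: (measurableT_comp (@measurable_cos R)).
  apply: measurable_funD => //; apply: measurable_sum => i.
  exact: measurable_funM.
by apply: measurable_funD => //; exact: measurable_funM.
Qed.

Lemma trig_integrable (R : realType) (d : measure_display) (T : measurableType d)
    (P : probability T R) (n : nat) (X : 'I_n -> T -> R) (F : ('I_n -> R) -> R) :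
  (forall i, measurable_fun setT (X i)) -> trig_poly F ->
  P.-integrable setT (EFin \o (fun w => F (X ^~ w))).
Proof.
move=> mX tF; have [M FM] := trig_bounded tF.
exact: (bounded_integrable P (trig_measurable mX tF) (fun w => FM (X ^~ w))).
Qed.

Section same_mean.
Context (R : realType) (d d' : measure_display) (T : measurableType d)
  (T' : measurableType d') (P : probability T R) (Q : probability T' R)
  (n : nat) (X : 'I_n -> T -> R) (Y : 'I_n -> T' -> R)
  (mX : forall i, measurable_fun setT (X i))
  (mY : forall i, measurable_fun setT (Y i)).

(** Measurability of both compositions is part of the notion, which makes it stable under bounded
    pointwise limits. *)
Definition same_mean (F : ('I_n -> R) -> R) : Prop :=
  [/\ measurable_fun setT (fun w => F (X ^~ w)),
      measurable_fun setT (fun w => F (Y ^~ w)) &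
      \int[P]_w F (X ^~ w) = \int[Q]_w F (Y ^~ w)].

Lemma same_mean_cvg (F_ : nat -> ('I_n -> R) -> R) (F : ('I_n -> R) -> R) (M : R) :
  (forall k, same_mean (F_ k)) -> (forall k x, `|F_ k x| <= M) ->
  (forall x, F_ ^~ x @ \oo --> F x) -> same_mean F.
Proof.
move=> sF FM cF.
have m1 k : measurable_fun setT (fun w => F_ k (X ^~ w)) by case: (sF k).
have m2 k : measurable_fun setT (fun w => F_ k (Y ^~ w)) by case: (sF k).
split.
- by apply: (measurable_fun_cvg m1) => w _; exact: (cF (X ^~ w)).
- by apply: (measurable_fun_cvg m2) => w _; exact: (cF (Y ^~ w)).
- have c1 := @bounded_cvg_Rintegral _ _ _ P (fun k w => F_ k (X ^~ w))
    (fun w => F (X ^~ w)) M m1 (fun k w => FM k (X ^~ w)) (fun w => cF (X ^~ w)).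
  have c2 := @bounded_cvg_Rintegral _ _ _ Q (fun k w => F_ k (Y ^~ w))
    (fun w => F (Y ^~ w)) M m2 (fun k w => FM k (Y ^~ w)) (fun w => cF (Y ^~ w)).
  have e : (fun k => \int[P]_w F_ k (X ^~ w)) = (fun k => \int[Q]_w F_ k (Y ^~ w)).
    by apply/funext => k; case: (sF k).
  by apply: (cvg_unique _ c1); [exact: norm_hausdorff|rewrite e].
Qed.

Hypothesis same_cos : forall (a : 'I_n -> R) (b : R),
  \int[P]_w cos (\sum_(i < n) a i * X i w + b) =
  \int[Q]_w cos (\sum_(i < n) a i * Y i w + b).

Lemma same_mean_trig (F : ('I_n -> R) -> R) : trig_poly F -> same_mean F.
Proof.
move=> tF; split; [exact: trig_measurable|exact: trig_measurable|].
elim: tF => [a b|k F1 F2 t1 e1 t2 e2]; first exact: same_cos.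
rewrite !RintegralD ?RintegralZl ?e1 ?e2//.
all: first [exact: (trig_integrable P mX t1)|exact: (trig_integrable P mX t2)
  |exact: (trig_integrable Q mY t1)|exact: (trig_integrable Q mY t2)
  |exact: (trig_integrable P mX (trig_scale k t1))
  |exact: (trig_integrable Q mY (trig_scale k t1))].
Qed.

End same_mean.

(* The Newton-Schulz iteration for the sign function: it stays polynomial in [u],
   preserves [-1, 1] and converges there to [Num.sg]. *)
Fixpoint sign_iter (R : realType) (k : nat) (u : R) : R :=
  if k is k'.+1 then sign_iter k' u * (3 - sign_iter k' u ^+ 2) / 2 else u.

Lemma sign_iter_odd (R : realType) (k : nat) (u : R) :
  sign_iter k (- u) = - sign_iter k u.
Proof. by elim: k => //= k ->; rewrite sqrrN !mulNr. Qed.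

(** If v is the current iterate, the next error is (1 - v) times (1 - v)(1 + v/2), and the second
    factor is at most 1 - v/2. As iterates never fall below [u], the error shrinks at least by the
    factor 1 - u/2. *)
Lemma sign_iter_gt0 (R : realType) (k : nat) (u : R) : 0 < u <= 1 ->
  u <= sign_iter k u <= 1 /\ 1 - sign_iter k u <= (1 - u / 2) ^+ k.
Proof.
move=> /andP[u0 u1]; elim: k => /= [|k [/andP[IH1 IH2] IH3]].
  by rewrite expr0; split; [rewrite lexx u1|lra].
set v := sign_iter k u in IH1 IH2 IH3 *.
have E : 1 - v * (3 - v ^+ 2) / 2 = (1 - v) * ((1 - v) * (1 + v / 2)) by field.
have v0 : 0 < v by lra.
have B : (1 - v) * (1 + v / 2) <= 1 - u / 2 by nra.
have B0 : 0 <= (1 - v) * (1 + v / 2) by nra.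
split; last first.
  rewrite E exprSr; apply: ler_pM => //; lra.
apply/andP; split; last by have : 0 <= (1 - v) * ((1 - v) * (1 + v / 2)); nra.
by apply: (le_trans IH1); nra.
Qed.

Lemma sign_iter_norm (R : realType) (k : nat) (u : R) : `|u| <= 1 ->
  `|sign_iter k u| <= 1.
Proof.
have pos (v : R) : 0 < v -> `|v| <= 1 -> `|sign_iter k v| <= 1.
  move=> v0; rewrite (gtr0_norm v0) => v1.
  have v01 : 0 < v <= 1 by rewrite v0 v1.
  have [/andP[a b] _] := sign_iter_gt0 k v01.
  by rewrite ger0_norm// (le_trans (ltW v0)).
move=> u1; have [u0|u0|u0] := ltgtP u 0; [|exact: pos|].
  by rewrite -normrN -sign_iter_odd pos// ?normrN// oppr_gt0.
suff -> : sign_iter k u = 0 by rewrite normr0.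
by rewrite u0; elim: k {pos} => //= k ->; rewrite mul0r mul0r.
Qed.

Lemma sign_iter_cvg (R : realType) (u : R) : `|u| <= 1 ->
  sign_iter k u @[k --> \oo] --> Num.sg u.
Proof.
have pos (v : R) : 0 < v -> `|v| <= 1 -> sign_iter k v @[k --> \oo] --> (1 : R).
  move=> v0; rewrite (gtr0_norm v0) => v1.
  have c1 : (1 - (1 - v / 2) ^+ k) @[k --> \oo] --> (1 : R).
    rewrite -[X in _ --> X]subr0; apply: cvgB; first exact: cvg_cst.
    by apply: cvg_expr; rewrite ger0_norm; lra.
  apply: (@squeeze_cvgr _ _ _ _ _ _ _ _ _ c1 (cvg_cst (1 : R))).
  have v01 : 0 < v <= 1 by rewrite v0 v1.
  apply: nearW => k; have [/andP[a b] c] := sign_iter_gt0 k v01.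
  by rewrite b andbT; lra.
move=> u1; have [u0|u0|->] := ltgtP u 0.
- rewrite ltr0_sg//.
  have c := pos (- u); rewrite oppr_gt0 normrN in c.
  have e : (fun k => sign_iter k u) = (fun k => - sign_iter k (- u)).
    by apply/funext => k; rewrite sign_iter_odd opprK.
  by rewrite e; exact: cvgN (c u0 u1).
- by rewrite gtr0_sg//; exact: pos.
- rewrite sgr0 (_ : (fun k => _) = cst 0); first exact: cvg_cst.
  by apply/funext; elim=> //= k ->; rewrite mul0r mul0r.
Qed.

Lemma trig_sign_iter (R : realType) (n k : nat) (F : ('I_n -> R) -> R) :
  trig_poly F -> trig_poly (fun x => sign_iter k (F x)).
Proof.
move=> tF; elim: k => //= k IH.
have t := trig_mul (trig_scale 2^-1 IH) (trig_lin (-1) (trig_mul IH IH) (trig_cst n 3)).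
by apply: (trig_ext _ t) => x; field.
Qed.

(* On [-1], [0], [1] the polynomial [(u + u ^ 2) / 2] is the indicator of [0 < u]. *)
Definition sign_gate (R : realType) (b : bool) (u : R) : R :=
  if b then (u + u ^+ 2) / 2 else 1 - (u + u ^+ 2) / 2.

Lemma trig_sign_gate (R : realType) (n : nat) (b : bool) (F : ('I_n -> R) -> R) :
  trig_poly F -> trig_poly (fun x => sign_gate b (F x)).
Proof.
move=> tF; have t := trig_scale 2^-1 (trig_add tF (trig_mul tF tF)).
case: b; first by apply: (trig_ext _ t) => x; rewrite /sign_gate; field.
by apply: (trig_ext _ (trig_lin (-1) t (trig_cst n 1))) => x; rewrite /sign_gate; field.
Qed.

Lemma sign_gate_norm (R : realType) (b : bool) (u : R) : `|u| <= 1 ->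
  `|sign_gate b u| <= 2.
Proof.
rewrite ler_norml => /andP[u1 u2]; rewrite /sign_gate ler_norml.
by case: b; apply/andP; split; nra.
Qed.

Lemma sign_gate_sg (R : realType) (b : bool) (u : R) :
  sign_gate b (Num.sg u) = ((0 < u) == b)%:R.
Proof. by rewrite /sign_gate; case: sgrP => _; case: b => /=; field. Qed.

Lemma sign_gate_cvg (R : realType) (b : bool) (u_ : nat -> R) (u : R) :
  u_ @ \oo --> u -> sign_gate b (u_ k) @[k --> \oo] --> sign_gate b u.
Proof.
move=> cu; have c : (u_ k + u_ k ^+ 2) / 2 @[k --> \oo] --> (u + u ^+ 2) / 2.
  apply: cvgM; last exact: cvg_cst.
  apply: cvgD => //; rewrite expr2; under eq_fun do rewrite expr2.
  exact: cvgM.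
by case: b => //; apply: cvgB => //; exact: cvg_cst.
Qed.

Lemma cvg_prod (R : realType) (I : Type) (s : seq I) (u_ : I -> nat -> R) (u : I -> R) :
  (forall i, u_ i @ \oo --> u i) ->
  \prod_(i <- s) u_ i k @[k --> \oo] --> \prod_(i <- s) u i.
Proof.
move=> cu; elim: s => [|i s IH].
  by rewrite big_nil; under eq_fun do rewrite big_nil; exact: cvg_cst.
by rewrite big_cons; under eq_fun do rewrite big_cons; exact: cvgM.
Qed.

Lemma sin_max (R : realType) (x : R) : `|sin x| <= 1.
Proof. by rewrite ler_norml sin_le1 sin_geN1. Qed.

(** The sine has the sign of [z] once |z| / (l + 1) < pi. It thus replaces the unbounded coordinate
    by a trigonometric polynomial with values in [-1, 1], as [sign_iter] requires. *)
Lemma near_sg_sin (R : realType) (z : R) :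
  \forall l \near \oo, Num.sg (sin (z / l.+1%:R)) = Num.sg z.
Proof.
have pos (x : R) : 0 < x -> \forall l \near \oo, 0 < sin (x / l.+1%:R).
  move=> x0; near=> l.
  have l0 : 0 < l.+1%:R :> R by rewrite ltr0n.
  apply: sin_gt0_pi; rewrite divr_gt0//= ltr_pdivrMr// mulrC -ltr_pdivrMr ?pi_gt0//.
  apply: (@lt_trans _ _ l%:R); last by rewrite ltr_nat.
  by near: l; exact: nbhs_infty_gtr.
have [z0|z0|->] := ltgtP z 0.
- have nz : 0 < - z by rewrite oppr_gt0.
  near=> l; rewrite (ltr0_sg z0) ltr0_sg// -oppr_gt0 -sinN -mulNr.
  by near: l; exact: pos.
- near=> l; rewrite (gtr0_sg z0) gtr0_sg//.
  by near: l; exact: pos.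
- by apply: nearW => l; rewrite mul0r sin0.
Unshelve. all: by end_near. Qed.

(** Two successive bounded limits: k to infinity turns [sign_iter] of the sine into its sign, and l
    to infinity turns that into the sign of x - h. The gates evaluate the sign exactly, also at 0,
    so atoms on the boundary of an orthant do no harm. *)
Lemma threshold_same_law (R : realType) (d d' : measure_display)
    (T : measurableType d) (T' : measurableType d') (P : probability T R)
    (Q : probability T' R) (n : nat) (X : 'I_n -> T -> R) (Y : 'I_n -> T' -> R) :
  (forall i, measurable_fun setT (X i)) -> (forall i, measurable_fun setT (Y i)) ->
  (forall (a : 'I_n -> R) (b : R),
    \int[P]_w cos (\sum_(i < n) a i * X i w + b) =
    \int[Q]_w cos (\sum_(i < n) a i * Y i w + b)) ->
  forall (h : R) (y : {ffun 'I_n -> bool}),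
  P [set w | forall i, (h < X i w) = y i] = Q [set w | forall i, (h < Y i w) = y i].
Proof.
move=> mX mY same h y.
pose sinl (l : nat) i (x : 'I_n -> R) : R := sin ((x i - h) / l.+1%:R).
have tsin l i : trig_poly (sinl l i).
  apply: (trig_ext _ (trig_cos (fun j => (j == i)%:R / l.+1%:R)
    (- h / l.+1%:R - pi / 2))) => x.
  rewrite addrA cosBpihalf /sinl (bigD1 i)//= eqxx big1 ?addr0; last first.
    by move=> j /negbTE ->; rewrite !mul0r.
  by congr sin; rewrite mul1r; ring.
have nsin l i x : `|sinl l i x| <= 1 by exact: sin_max.
have s1 l k : same_mean P Q X Y (fun x =>
    \prod_i sign_gate (y i) (sign_iter k (sinl l i x))).
  apply: same_mean_trig => //; apply: trig_prod => i.
  by apply: trig_sign_gate; exact: trig_sign_iter.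
have bnd (v : 'I_n -> R) : (forall i, `|v i| <= 1) ->
    `|\prod_i sign_gate (y i) (v i)| <= \prod_(i < n) 2.
  move=> v1; rewrite normr_prod; apply: ler_prod => i _.
  by rewrite normr_ge0 sign_gate_norm.
have s2 l : same_mean P Q X Y (fun x =>
    \prod_i sign_gate (y i) (Num.sg (sinl l i x))).
  apply: (same_mean_cvg (s1 l)) => [k x|x].
    by apply: bnd => i; exact: sign_iter_norm.
  by apply: cvg_prod => i; apply: sign_gate_cvg; exact: sign_iter_cvg.
have s3 : same_mean P Q X Y (fun x =>
    \prod_i sign_gate (y i) (Num.sg (x i - h))).
  apply: (same_mean_cvg s2) => [l x|x].
    by apply: bnd => i; case: sgrP; rewrite ?normr0 ?normrN ?normr1.
  apply: cvg_prod => i; apply: sign_gate_cvg.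
  apply: (cvg_near_cst _ (near_sg_sin (x i - h))).
have indE (U : Type) (Z : 'I_n -> U -> R) :
    (fun w => \prod_i sign_gate (y i) (Num.sg (Z i w - h))) =
    \1_[set w | forall i, (h < Z i w) = y i].
  apply/funext => w; rewrite indicE.
  under eq_bigr do rewrite sign_gate_sg subr_gt0.
  case: (asboolP (forall i, (h < Z i w) = y i)) => H.
    by rewrite mem_set//= big1// => i _; rewrite H eqxx.
  rewrite memNset//=.
  have /existsNP[i /eqP Hi] := H.
  by rewrite (bigD1 i)//= (negbTE Hi) mul0r.
(* [same_mean] carries measurability of the indicator, from which that of the event is recovered. *)
have mind d0 (U : measurableType d0) (A : set U) :
    measurable_fun setT (\1_A : U -> R) -> measurable A.
  move=> m; rewrite (_ : A = \1_A @^-1` [set (1 : R)]).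
    by rewrite -[X in measurable X]setTI; apply: m.
  apply/seteqP; split=> w /=; rewrite indicE; first by move/mem_set => ->.
  by case: (boolP (w \in A)) => [/set_mem//|_ /eqP]; rewrite eq_sym oner_eq0.
case: s3; rewrite !indE => /mind m1 /mind m2.
rewrite /Rintegral !integral_indic// !setIT => e.
by rewrite -[LHS]fineK ?fin_num_measure// e fineK ?fin_num_measure.
Qed.

(** * Gaussian integrals *)

(** The Radon-Nikodym derivative of [normal_prob] agrees almost everywhere with the density, because
    both have the same integral over every measurable set. *)
Lemma ge0_integral_normal_prob (R : realType) (m s : R) (f : R -> \bar R)
    (E : set R) :
  (forall x, (0 <= f x)%E) -> measurable E -> measurable_fun E f ->
  (\int[normal_prob m s]_(x in E) f x =
   \int[lebesgue_measure]_(x in E) (f x * (normal_pdf m s x)%:E))%E.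
Proof.
move=> f0 mE mf.
have dom := @normal_prob_dominates R m s.
rewrite -(Radon_Nikodym_SigmaFinite.change_of_variables dom)//.
have mpdf : measurable_fun setT (fun x => (normal_pdf m s x)%:E).
  by apply/measurable_EFinP; exact: measurable_normal_pdf.
apply: ae_eq_integral => //.
- apply: emeasurable_funM => //; apply: measurable_funTS.
  exact: (measurable_int _ (Radon_Nikodym_SigmaFinite.f_integrable dom)).
- by apply: emeasurable_funM => //; exact: measurable_funTS.
- apply: ae_eqe_mul2l; apply: integral_ae_eq => //.
  + apply: (integrableS measurableT) => //.
    exact: Radon_Nikodym_SigmaFinite.f_integrable.
  + exact: measurable_funTS.
  + by move=> A AE mA; rewrite -Radon_Nikodym_SigmaFinite.f_integral.
Qed.

Lemma normal_prob_integrable (R : realType) (m s : R) (f : R -> R) :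
  measurable_fun setT f ->
  lebesgue_measure.-integrable setT (fun x => (f x * normal_pdf m s x)%:E) ->
  (normal_prob m s).-integrable setT (EFin \o f).
Proof.
move=> mf /integrableP[_ fi]; apply/integrableP; split; first exact/measurable_EFinP.
rewrite ge0_integral_normal_prob//; last first.
  by apply: measurableT_comp => //; exact/measurable_EFinP.
by move: fi; under eq_integral do
  rewrite EFinM abseM [X in (_ * X)%E]gee0_abs ?lee_fin ?normal_pdf_ge0//.
Qed.

Lemma Rintegral_normal_prob (R : realType) (m s : R) (f : R -> R) :
  measurable_fun setT f ->
  lebesgue_measure.-integrable setT (fun x => (f x * normal_pdf m s x)%:E) ->
  \int[normal_prob m s]_x f x = \int[lebesgue_measure]_x (f x * normal_pdf m s x).
Proof.
move=> mf fi; rewrite /Rintegral; congr fine.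
have mE : measurable_fun setT (EFin \o f) by exact/measurable_EFinP.
have pos x : (0 <= (normal_pdf m s x)%:E)%E by rewrite lee_fin normal_pdf_ge0.
rewrite integralE [RHS]integralE !ge0_integral_normal_prob//.
- congr (_ - _)%E; apply: eq_integral => x _.
  + by rewrite /= !funeposE/= -!EFin_max -EFinM maxr_pMl ?normal_pdf_ge0// mul0r.
  + by rewrite /= !funenegE/= -!EFin_max -EFinM maxr_pMl ?normal_pdf_ge0// mul0r -mulNr.
- exact: measurable_funeneg.
- exact: measurable_funepos.
Qed.

(** The fundamental theorem on [-(k+1), k+1], then dominated convergence; k+1 keeps the interval
    nondegenerate. *)
Lemma Rintegral_derivative_eq0 (R : realType) (F f : R -> R) :
  continuous f -> (forall x, is_derive x (1 : R) F (f x)) ->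
  lebesgue_measure.-integrable setT (EFin \o f) ->
  F x @[x --> +oo] --> (0 : R) -> F (- x) @[x --> +oo] --> (0 : R) ->
  \int[lebesgue_measure]_x f x = 0.
Proof.
move=> cf dF fi Fp Fn.
have E (k : nat) : (\int[lebesgue_measure]_(x in `[(- k.+1%:R)%R, k.+1%:R%R]) (f x)%:E
    = (F k.+1%:R%R)%:E - (F (- k.+1%:R)%R)%:E)%E.
  apply: continuous_FTC2.
  - by rewrite (@lt_trans _ _ 0) ?oppr_lt0 ?ltr0n.
  - exact: continuous_subspaceT.
  - have cF : continuous F.
      by move=> x; apply/differentiable_continuous/derivable1_diffP; case: (dF x).
    split; first by move=> x _; case: (dF x).
    + exact: cvg_at_right_filter (cF _).
    + exact: cvg_at_left_filter (cF _).
  - by move=> x _; rewrite derive1E; have [_ ->] := dF x.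
have mf : measurable_fun setT f by exact: continuous_measurable_fun.
have c1 : (\int[lebesgue_measure]_(x in `[(- k.+1%:R)%R, k.+1%:R%R]) (f x)%:E)%E @[k --> \oo]
    --> (\int[lebesgue_measure]_x (f x)%:E)%E.
  rewrite (_ : (fun k : nat => _) = (fun k : nat => \int[lebesgue_measure]_x
    ((EFin \o f) \_ `[(- k.+1%:R)%R, k.+1%:R%R]) x)%E); last first.
    by apply/funext => k; rewrite integral_mkcond.
  apply: (@dominated_cvg _ _ _ (@lebesgue_measure R) setT measurableT
    (fun k => (EFin \o f) \_ `[(- k.+1%:R)%R, k.+1%:R%R])
    (EFin \o f) (fun x => `|f x|%:E)) => //.
  - move=> k; apply/(measurable_restrictT _ _).1 => //.
    by apply: measurable_funTS; exact/measurable_EFinP.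
  - move=> x _; apply: cvg_near_cst; near=> k; rewrite patchE mem_set//=.
    rewrite in_itv/= -ler_norml; apply: (@le_trans _ _ k%:R); last by rewrite ler_nat.
    by near: k; exact: nbhs_infty_ger.
  - exact: integrable_norm.
  - move=> k x _; rewrite patchE; case: ifP => _ /=; first by rewrite lee_fin.
    by rewrite normr0 lee_fin.
have nat_y : (fun k => k.+1%:R : R) @ \oo --> +oo.
  have := @cvgr_idn R; rewrite -(cvg_shiftn 1); apply: cvg_trans.
  by under [in X in _ `=>` X]eq_fun do rewrite addn1.
have c2 : (\int[lebesgue_measure]_(x in `[(- k.+1%:R)%R, k.+1%:R%R]) (f x)%:E)%E @[k --> \oo]
    --> (0 - 0)%:E.
  under eq_fun do rewrite E -EFinB.
  apply: cvg_EFin; first exact: nearW.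
  apply: cvgB; first exact: (cvg_comp _ _ nat_y Fp).
  exact: (cvg_comp _ _ nat_y Fn).
rewrite subr0 in c2.
by rewrite /Rintegral -(cvg_lim _ c1)// (cvg_lim _ c2).
Unshelve. all: by end_near. Qed.

Lemma normal_pdf_derive (R : realType) (m s x : R) : s != 0 ->
  is_derive x (1 : R) (normal_pdf m s) (- ((x - m) / s ^+ 2) * normal_pdf m s x).
Proof.
move=> s0; rewrite (normal_pdfE _ s0).
have d1 : is_derive x (1 : R) (fun x : R => - (x - m) ^+ 2 / (s ^+ 2 *+ 2))
    (- ((x - m) / s ^+ 2)).
  apply: is_derive_eq; rewrite /GRing.scale/=; field.
  by rewrite s0.
have d2 := @is_derive1_comp R (@expR R) _ _ _ _ (is_derive_expR _) d1.
have d3 := @is_deriveZ _ _ _ _ (normal_peak s) _ _ _ d2.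
have -> : - ((x - m) / s ^+ 2) * (normal_peak s * normal_fun m s x) =
  normal_peak s *: (expR (- (x - m) ^+ 2 / (s ^+ 2 *+ 2)) * - ((x - m) / s ^+ 2)).
  by rewrite /GRing.scale/= /normal_fun; ring.
exact: d3.
Qed.

(** Half of the exponent suffices to absorb the quadratic factor, by 1 + x <= exp x; the other half
    is a Gaussian of standard deviation sqrt 2 times larger. Integrability of moments and decay at
    infinity both come from this bound. *)
Lemma normal_pdf_sqr_bound (R : realType) (m s : R) : s != 0 ->
  exists C, forall x, (1 + (x - m) ^+ 2) * normal_pdf m s x
    <= C * normal_pdf m (Num.sqrt 2 * s) x.
Proof.
move=> s0; have r2 : Num.sqrt (2 : R) ^+ 2 = 2 by rewrite sqr_sqrtr.
have s2 : 0 < s ^+ 2 by rewrite exprn_even_gt0.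
have s0' : Num.sqrt 2 * s != 0 by rewrite mulf_neq0// sqrtr_eq0 -ltNge.
exists (normal_peak s * (1 + 4 * s ^+ 2) / normal_peak (Num.sqrt 2 * s)) => x.
rewrite !normal_pdfE//.
rewrite -(mulrA (normal_peak s * _)) mulKf ?gt_eqF ?normal_peak_gt0//.
rewrite mulrCA -mulrA ler_wpM2l ?normal_peak_ge0// /normal_fun exprMn r2.
set y := (x - m) ^+ 2; have y0 : 0 <= y by exact: sqr_ge0.
rewrite (_ : - y / (s ^+ 2 *+ 2) = - (y / (4 * s ^+ 2)) - y / (4 * s ^+ 2)); last first.
  by field.
rewrite (_ : - y / (2 * s ^+ 2 *+ 2) = - (y / (4 * s ^+ 2))); last by field.
rewrite expRD mulrCA mulrC ler_wpM2r ?expR_ge0//.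
rewrite expRN ler_pdivrMr ?expR_gt0//.
have := expR_ge1Dx (y / (4 * s ^+ 2)); set u := y / (4 * s ^+ 2) => Hu.
have yE : y = u * (4 * s ^+ 2) by rewrite /u; field.
have u0 : 0 <= u by rewrite /u divr_ge0// mulr_ge0// ltW.
rewrite yE; apply: (@le_trans _ _ ((1 + 4 * s ^+ 2) * (1 + u))); first by nra.
by rewrite ler_wpM2l//; nra.
Qed.

Lemma normal_moment_integrable (R : realType) (m s C : R) (g : R -> R) : s != 0 ->
  measurable_fun setT g -> (forall x, `|g x| <= C * (1 + (x - m) ^+ 2)) ->
  lebesgue_measure.-integrable setT (fun x => (g x * normal_pdf m s x)%:E).
Proof.
move=> s0 mg gC; have [D HD] := normal_pdf_sqr_bound m s0.
have i := integrable_normal_pdf m (Num.sqrt 2 * s).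
have /(integrableZl measurableT (C * D)) {}i := i.
apply: le_integrable i => //.
  apply/measurable_EFinP; apply: measurable_funM => //; exact: measurable_normal_pdf.
move=> x _; rewrite /= lee_fin normrM (ger0_norm (normal_pdf_ge0 _ _ _)).
apply: le_trans (ler_norm _).
have C0 : 0 <= C.
  have := le_trans (normr_ge0 _) (gC m).
  by rewrite subrr expr0n/= addr0 mulr1.
rewrite -mulrA; apply: le_trans (ler_wpM2l C0 (HD x)).
by rewrite mulrA ler_wpM2r ?normal_pdf_ge0.
Qed.

(** With a = |x - m|, the inequality (1 + a)a <= 3(1 + a^2) and the previous bound show that |g w| a
    is bounded; dividing by a gives the decay. *)
Lemma normal_decay (R : realType) (m s C : R) (g : R -> R) : s != 0 ->
  (forall x, `|g x| <= C * (1 + `|x - m|)) ->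
  (g x * normal_pdf m s x @[x --> +oo] --> (0 : R)) /\
  (g (- x) * normal_pdf m s (- x) @[x --> +oo] --> (0 : R)).
Proof.
move=> s0 gC; have [D HD] := normal_pdf_sqr_bound m s0.
pose K := `|3 * C * D * normal_peak (Num.sqrt 2 * s)|.
have C0 : 0 <= C.
  have := le_trans (normr_ge0 _) (gC m).
  by rewrite subrr normr0 addr0 mulr1.
have s0' : Num.sqrt 2 * s != 0 by rewrite mulf_neq0// sqrtr_eq0 -ltNge.
have B x : `|g x * normal_pdf m s x| * `|x - m| <= K.
  have w0 := normal_pdf_ge0 m s x.
  have D0 : 0 <= D * normal_pdf m (Num.sqrt 2 * s) x.
    apply: le_trans (HD x); rewrite mulr_ge0// addr_ge0// sqr_ge0//.
  have HD' : (1 + (x - m) ^+ 2) * normal_pdf m s x <= D * normal_peak (Num.sqrt 2 * s).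
    apply: (le_trans (HD x)).
    have Dge : 0 <= D.
      move: D0; rewrite pmulr_lge0//; rewrite normal_pdfE//.
      by rewrite mulr_gt0 ?normal_peak_gt0// expR_gt0.
    by rewrite ler_wpM2l// normal_pdf_ub.
  apply: le_trans (ler_norm _); rewrite normrM (ger0_norm w0).
  set a := `|x - m| in gC *; have a0 : 0 <= a by exact: normr_ge0.
  have aE : (x - m) ^+ 2 = a ^+ 2 by rewrite /a real_normK ?num_real.
  rewrite aE in HD'.
  apply: (@le_trans _ _ (C * (1 + a) * normal_pdf m s x * a)).
    by rewrite ler_wpM2r// ler_wpM2r// gC.
  rewrite (_ : 3 * C * D * _ = 3 * C * (D * normal_peak (Num.sqrt 2 * s))); last by ring.
  apply: (@le_trans _ _ (3 * C * ((1 + a ^+ 2) * normal_pdf m s x))); last first.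
    by rewrite ler_wpM2l// mulr_ge0.
  rewrite -subr_ge0 (_ : _ - _ = C * normal_pdf m s x * (3 - a + 2 * a ^+ 2)); last by ring.
  by rewrite mulr_ge0 ?mulr_ge0//; nra.
have small x e : 0 < e -> K / e <= `|x - m| -> 0 < `|x - m| ->
    `|g x * normal_pdf m s x| <= e.
  move=> e0 H1 H2; rewrite -(ler_pM2r H2) (le_trans (B x))//.
  by rewrite mulrC -ler_pdivrMr.
have K0 : 0 <= K by exact: normr_ge0.
split; apply/cvgrPdist_le => e e0; near=> x; rewrite sub0r normrN.
- have H1 : K / e <= `|x - m|.
    rewrite (le_trans _ (ler_norm _))// lerBrDr; near: x; apply: nbhs_pinfty_ge.
    exact: num_real.
  apply: small => //; rewrite normr_gt0 subr_eq0 gt_eqF//; near: x.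
  by apply: nbhs_pinfty_gt; exact: num_real.
- have H1 : K / e <= `|- x - m|.
    rewrite -normrN opprB opprK (le_trans _ (ler_norm _))// -lerBlDl; near: x.
    by apply: nbhs_pinfty_ge; exact: num_real.
  apply: small => //; rewrite normr_gt0 lt_eqF// subr_lt0 ltrNl.
  by near: x; apply: nbhs_pinfty_gt; exact: num_real.
Unshelve. all: by end_near. Qed.

Lemma is_derive_continuous (R : realType) (g g' : R -> R) :
  (forall x, is_derive x (1 : R) g (g' x)) -> continuous g.
Proof.
by move=> dg x; apply/differentiable_continuous/derivable1_diffP; case: (dg x).
Qed.

(** Gaussian integration by parts: - s^2 g w vanishes at both infinities, and its derivative is the
    difference of the two integrands. It serves with g constant, affine (the moments) and a sine
    (the characteristic function). *)
Lemma normal_stein (R : realType) (m s C : R) (g g' : R -> R) : s != 0 ->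
  (forall x, is_derive x (1 : R) g (g' x)) -> continuous g' ->
  (forall x, `|g x| <= C * (1 + `|x - m|)) ->
  (forall x, `|g' x| <= C * (1 + (x - m) ^+ 2)) ->
  \int[lebesgue_measure]_x ((x - m) * g x * normal_pdf m s x) =
  s ^+ 2 * \int[lebesgue_measure]_x (g' x * normal_pdf m s x).
Proof.
move=> s0 dg cg' gC g'C.
have C0 : 0 <= C.
  have := le_trans (normr_ge0 _) (gC m).
  by rewrite subrr normr0 addr0 mulr1.
have cg := is_derive_continuous dg.
have cm : continuous (fun x : R => x - m).
  by move=> x; apply: cvgB; [exact: cvg_id|exact: cvg_cst].
have cw := @continuous_normal_pdf R m s s0.
have i1 : lebesgue_measure.-integrable setT
    (fun x => ((x - m) * g x * normal_pdf m s x)%:E).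
  apply: (normal_moment_integrable (C := 2 * C)) => //.
    by apply: continuous_measurable_fun => x; apply: cvgM; [exact: cm|exact: cg].
  move=> x; rewrite normrM.
  apply: le_trans (ler_wpM2l (normr_ge0 _) (gC x)) _.
  rewrite -(@real_normK _ (x - m)) ?num_real//.
  set a := `|x - m|; have a0 : 0 <= a by exact: normr_ge0.
  rewrite -subr_ge0 (_ : _ - _ = C * (2 - a + a ^+ 2)); last by ring.
  by rewrite mulr_ge0//; nra.
have i2 : lebesgue_measure.-integrable setT (fun x => (g' x * normal_pdf m s x)%:E).
  by apply: (normal_moment_integrable (C := C)) => //; exact: continuous_measurable_fun.
have i2s : lebesgue_measure.-integrable setT
    (fun x => (s ^+ 2 * (g' x * normal_pdf m s x))%:E).
  by have /(integrableZl measurableT (s ^+ 2)) := i2; apply: eq_integrable.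
apply/eqP; rewrite -RintegralZl// -subr_eq0 -RintegralB//; apply/eqP.
apply: (@Rintegral_derivative_eq0 _ (fun x => - s ^+ 2 * g x * normal_pdf m s x)
  (fun x => (x - m) * g x * normal_pdf m s x - s ^+ 2 * (g' x * normal_pdf m s x))).
- move=> x; apply: cvgB; apply: cvgM.
  + by apply: cvgM; [exact: cm|exact: cg].
  + exact: cw.
  + exact: cvg_cst.
  + by apply: cvgM; [exact: cg'|exact: cw].
- move=> x; have dw := normal_pdf_derive m x s0.
  have d1 := @is_deriveM _ _ _ _ _ _ _ _ (dg x) dw.
  have d2 := @is_deriveZ _ _ _ _ (- s ^+ 2) _ _ _ d1.
  rewrite (_ : (fun x => _) = (- s ^+ 2) \*: (g * normal_pdf m s)); last first.
    by apply/funext => y; rewrite /= !fctE /GRing.scale/= mulrA.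
  rewrite (_ : _ - _ = - s ^+ 2 *: (g x *: (- ((x - m) / s ^+ 2) * normal_pdf m s x) +
     normal_pdf m s x *: g' x)); first exact: d2.
  by rewrite /GRing.scale/=; field.
- by have := integrableB measurableT i1 i2s; apply: eq_integrable.
- apply: (normal_decay (C := s ^+ 2 * C) (g := fun x => - s ^+ 2 * g x) s0 _).1 => x.
  by rewrite normrM normrN (ger0_norm (sqr_ge0 s)) -mulrA ler_wpM2l ?sqr_ge0.
- apply: (normal_decay (C := s ^+ 2 * C) (g := fun x => - s ^+ 2 * g x) s0 _).2 => x.
  by rewrite normrM normrN (ger0_norm (sqr_ge0 s)) -mulrA ler_wpM2l ?sqr_ge0.
Qed.

Lemma Rintegral_normal_pdf (R : realType) (m s : R) :
  \int[lebesgue_measure]_x normal_pdf m s x = 1.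
Proof. by rewrite /Rintegral integral_normal_pdf. Qed.

Lemma normal_pdf_moment1 (R : realType) (m s : R) : s != 0 ->
  \int[lebesgue_measure]_x ((x - m) * normal_pdf m s x) = 0.
Proof.
move=> s0; have := @normal_stein R m s 1 (cst 1) (cst 0) s0 _ _ _ _.
under eq_Rintegral do rewrite /= mulr1.
under [in X in _ -> _ -> _ -> _ -> _ = _ * X]eq_Rintegral do rewrite /= mul0r.
rewrite (Rintegral_cst _ measurableT) mul0r mulr0; apply.
- by move=> x; exact: cvg_cst.
- by move=> x; rewrite /= normr1 mul1r lerDl.
- by move=> x; rewrite /= normr0 mul1r addr_ge0// sqr_ge0.
Qed.

Lemma normal_pdf_moment2 (R : realType) (m s : R) : s != 0 ->
  \int[lebesgue_measure]_x ((x - m) ^+ 2 * normal_pdf m s x) = s ^+ 2.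
Proof.
move=> s0; have d x : is_derive x (1 : R) (fun x : R => x - m) (cst 1 x).
  by rewrite -[cst 1 x]subr0; apply: is_deriveB.
have := @normal_stein R m s 1 (fun x => x - m) (cst 1) s0 d _ _ _.
under eq_Rintegral do rewrite -expr2.
under [in X in _ -> _ -> _ -> _ = _ * X]eq_Rintegral do rewrite /= mul1r.
rewrite Rintegral_normal_pdf mulr1; apply.
- by move=> x; exact: cvg_cst.
- by move=> x; rewrite mul1r lerDr.
- by move=> x; rewrite /= normr1 mul1r lerDl sqr_ge0.
Qed.

Section normal_cos.
Context (R : realType) (m s e : R) (s0 : s != 0).

Local Notation w := (normal_pdf m s).
Let mu := @lebesgue_measure R.
Let f (t x : R) : R := cos (t * (x - m) + e) * w x.
Let G (t : R) : R := \int[mu]_x f t x.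

Let cphase t : continuous (fun x : R => t * (x - m) + e).
Proof.
move=> x; apply: cvgD; last exact: cvg_cst.
by apply: cvgM; [exact: cvg_cst|apply: cvgB; [exact: cvg_id|exact: cvg_cst]].
Qed.

Let dphase t x : is_derive x (1 : R) (fun x : R => t * (x - m) + e) t.
Proof. by apply: is_derive_eq; rewrite /GRing.scale/=; ring. Qed.

Let int_f t : mu.-integrable setT (EFin \o f t).
Proof.
apply: (normal_moment_integrable (C := 1)) => //.
  by apply: (measurableT_comp (@measurable_cos R)); exact: continuous_measurable_fun.
by move=> x; rewrite mul1r (le_trans (cos_max _))// lerDl sqr_ge0.
Qed.

Let df t x : is_derive t (1 : R) (f ^~ x) (- sin (t * (x - m) + e) * (x - m) * w x).
Proof.
have d1 : is_derive t (1 : R) (fun t : R => t * (x - m) + e) (x - m).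
  by apply: is_derive_eq; rewrite /GRing.scale/=; ring.
have d2 := @is_derive1_comp R (@cos R) _ _ _ _ (is_derive_cos _) d1.
have d3 := @is_deriveZ _ _ _ _ (w x) _ _ _ d2.
rewrite (_ : f ^~ x = w x \*: (@cos R \o (fun t => t * (x - m) + e))); last first.
  by apply/funext => u; rewrite /f /= /GRing.scale/= mulrC.
by rewrite mulrC; exact: d3.
Qed.

(** Differentiation under the integral, dominated by |x - m| w, produces a sine; Stein's identity
    turns it back into [G]. The result is a linear differential equation for [G]. *)
Let dG t : is_derive t (1 : R) G (- (s ^+ 2 * t) * G t).
Proof.
pose bound (y : R) := `|y - m| * w y.
have b0 y : 0 <= bound y by rewrite mulr_ge0 ?normal_pdf_ge0.
have ib : mu.-integrable setT (EFin \o bound).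
  apply: (normal_moment_integrable (C := 1)) => //.
    by apply: measurableT_comp => //; exact: measurable_funB.
  move=> x; rewrite normr_id mul1r -(@real_normK _ (x - m)) ?num_real//.
  by have := normr_ge0 (x - m); nra.
have ub x y : `]t - 1, t + 1[%classic x -> setT y -> `|partial1of2 f x y| <= bound y.
  move=> _ _; rewrite partial1of2E; have [_ ->] := df x y.
  rewrite !normrM normrN (ger0_norm (normal_pdf_ge0 _ _ _)).
  by rewrite ler_wpM2r ?normal_pdf_ge0// ler_piMl// sin_max.
have It : `]t - 1, t + 1[%classic t by rewrite /= in_itv/=; apply/andP; split; lra.
have der x y : `]t - 1, t + 1[%classic x -> setT y -> derivable (f ^~ y) x 1.
  by move=> _ _; case: (df x y).
have E := @differentiation_under_integral _ _ _ mu f setT measurableT t (t - 1) (t + 1)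
  It (fun x _ => int_f x) der bound b0 ib ub.
have D := @derivable_under_integral _ _ _ mu f setT measurableT t (t - 1) (t + 1)
  It (fun x _ => int_f x) der bound b0 ib ub.
apply: DeriveDef => //; rewrite -derive1E E.
have c1 : continuous (fun x : R => t * cos (t * (x - m) + e)).
  move=> x; apply: cvgM; first exact: cvg_cst.
  by apply: (cvg_comp _ _ (@cphase t x)); exact: continuous_cos.
have d1 x : is_derive x (1 : R) (fun x => sin (t * (x - m) + e))
    (t * cos (t * (x - m) + e)).
  have := @is_derive1_comp R (@sin R) _ _ _ _ (is_derive_sin _) (dphase t x).
  by rewrite mulrC.
have b1 x : `|sin (t * (x - m) + e)| <= (1 + `|t|) * (1 + `|x - m|).
  rewrite (le_trans (sin_max _))//.
  by have := normr_ge0 t; have := normr_ge0 (x - m); nra.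
have b2 x : `|t * cos (t * (x - m) + e)| <= (1 + `|t|) * (1 + (x - m) ^+ 2).
  rewrite normrM (le_trans (ler_wpM2l (normr_ge0 _) (cos_max _)))//.
  by have := normr_ge0 t; have := sqr_ge0 (x - m); nra.
have stein := normal_stein s0 d1 c1 b1 b2.
have tG : \int[mu]_x (t * cos (t * (x - m) + e) * w x) = t * G t.
  by rewrite -RintegralZl//; apply: eq_Rintegral => x _; rewrite /f mulrA.
rewrite tG in stein; rewrite mulNr -mulrA -stein.
rewrite -[RHS]mulN1r -RintegralZl//; last first.
  apply: (normal_moment_integrable (C := 1)) => //.
    apply: measurable_funM; first exact: measurable_funB.
    by apply: continuous_measurable_fun; exact: is_derive_continuous d1.
  move=> x; rewrite normrM mul1r -(@real_normK _ (x - m)) ?num_real//.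
  apply: le_trans (ler_wpM2l (normr_ge0 _) (sin_max _)) _.
  by have := normr_ge0 (x - m); nra.
apply: eq_Rintegral => x _; rewrite partial1of2E; have [_ ->] := df t x.
by ring.
Qed.

(** By [dG] the product of [G] and exp((s t)^2 / 2) has derivative 0, so it keeps its value cos e at
    t = 0. *)
Lemma normal_pdf_cos (t : R) :
  \int[mu]_x (cos (t * (x - m) + e) * w x) = expR (- (s * t) ^+ 2 / 2) * cos e.
Proof.
have dE (x : R) : is_derive x (1 : R) (fun t => expR ((s * t) ^+ 2 / 2))
    ((s ^+ 2 * x) * expR ((s * x) ^+ 2 / 2)).
  have d1 : is_derive x (1 : R) (fun t => (s * t) ^+ 2 / 2) (s ^+ 2 * x).
    by apply: is_derive_eq; rewrite /GRing.scale/=; field.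
  have := @is_derive1_comp R (@expR R) _ _ _ _ (is_derive_expR _) d1.
  by rewrite mulrC.
have dH (x : R) : is_derive x (1 : R) (G * (fun t => expR ((s * t) ^+ 2 / 2))) 0.
  have := @is_deriveM _ _ _ _ _ _ _ _ (dG x) (dE x).
  rewrite (_ : _ + _ = 0)//.
  by rewrite /GRing.scale/=; ring.
have H := is_derive_0_is_cst t 0 dH.

have {}H : G t * expR ((s * t) ^+ 2 / 2) = G 0 * expR ((s * 0) ^+ 2 / 2) := H.
have G0 : G 0 = cos e.
  rewrite /G /f; under eq_Rintegral do rewrite mul0r add0r.
  rewrite RintegralZl ?Rintegral_normal_pdf ?mulr1//.
  exact: integrable_normal_pdf.
move: H; rewrite mulr0 expr0n/= mul0r expR0 mulr1 G0 => H.
by rewrite -H -/G mulNr expRN mulrCA mulVf ?mulr1// gt_eqF// expR_gt0.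
Qed.

End normal_cos.

Lemma transfer_law (R : realType) (d : measure_display) (T : measurableType d)
    (P : probability T R) (N : {measure set (measurableTypeR R) -> \bar R})
    (Z : T -> R) (f : R -> R) :
  measurable_fun setT Z -> (forall B : set R, measurable B -> P (Z @^-1` B) = N B) ->
  measurable_fun setT f -> N.-integrable setT (EFin \o f) ->
  P.-integrable setT (EFin \o (f \o Z)) /\
  \int[P]_w f (Z w) = \int[N]_x f x.
Proof.
move=> mZ law mf fi.
have mE : measurable_fun setT (EFin \o f) by exact/measurable_EFinP.
have E (g : R -> \bar R) : measurable_fun setT g -> (forall x, (0 <= g x)%E) ->
    (\int[P]_w (g (Z w)) = \int[N]_x g x)%E.
  move=> mg g0.
  have := @ge0_integral_pushforward _ _ T (measurableTypeR R) R Z mZ P setT g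
    measurableT mg (fun x _ => g0 x).
  rewrite preimage_setT => <-; apply: eq_measure_integral => A mA _.
  exact: law.
split.
  apply/integrableP; split.
    by apply/measurable_EFinP; exact: measurableT_comp.
  case/integrableP: fi => _; rewrite -E//; last exact: measurableT_comp.
rewrite /Rintegral; congr fine; rewrite integralE [RHS]integralE -!E//.
- by congr (_ - _)%E; apply: eq_integral => w _; rewrite ?funeposE ?funenegE.
- exact: measurable_funeneg.
- exact: measurable_funepos.
Qed.

Lemma is_gaussian_facts (R : realType) (d : measure_display) (T : measurableType d)
    (P : probability T R) (Z : T -> R) :
  measurable_fun setT Z -> is_gaussian P Z -> exists m s : R,
  [/\ 0 <= s, forall B : set R, measurable B -> P (Z @^-1` B) = gaussian_law m s B,
      P.-integrable setT (EFin \o Z) & P.-integrable setT (EFin \o (fun w => Z w ^+ 2))] /\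
  [/\ \int[P]_w Z w = m, \int[P]_w (Z w ^+ 2) = m ^+ 2 + s ^+ 2 &
      forall b, \int[P]_w cos (Z w + b) = expR (- s ^+ 2 / 2) * cos (m + b)].
Proof.
move=> mZ [m [s [s_ge0 law0]]]; exists m, s; have law := law0.
have mid : measurable_fun setT (@idfun R) by exact: measurable_id.
have msq : measurable_fun setT (fun x : R => x ^+ 2) by exact: measurable_funX.
have mcos b : measurable_fun setT (fun x : R => cos (x + b)).
  by apply: (measurableT_comp (@measurable_cos R)); exact: measurable_funD.
move: law; rewrite /gaussian_law; case: (eqVneq s 0) => [s0 law|s0 law].
  have {s0} s2 : s ^+ 2 = 0 by rewrite s0 expr0n.
  have di f : measurable_fun setT f ->
      (@dirac _ (measurableTypeR R) m R).-integrable setT (EFin \o f).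
    move=> mf; apply/integrableP; split; first exact/measurable_EFinP.
    rewrite integral_dirac//; last by apply: measurableT_comp => //; exact/measurable_EFinP.
    by rewrite diracT mul1e ltry.
  have dv f : measurable_fun setT f ->
      \int[@dirac _ (measurableTypeR R) m R]_x f x = f m.
    move=> mf; rewrite /Rintegral integral_dirac//; last exact/measurable_EFinP.
    by rewrite diracT mul1e.
  have [i1 e1] := @transfer_law _ _ _ P (@dirac _ (measurableTypeR R) m R) Z _ mZ law mid
    (di _ mid).
  have [i2 e2] := @transfer_law _ _ _ P (@dirac _ (measurableTypeR R) m R) Z _ mZ law msq
    (di _ msq).
  split; split => //; first by rewrite e1 dv.
    by rewrite e2 (dv _ msq) s2 addr0.
  move=> b; have [_ e3] := @transfer_law _ _ _ P (@dirac _ (measurableTypeR R) m R) Z _ mZ law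
    (mcos b) (di _ (mcos b)).
  by rewrite e3 (dv _ (mcos b)) s2 oppr0 mul0r expR0 mul1r.
(* Chosen so that both |x| and x^2 are at most K (1 + (x - m)^2). *)
pose K := 2 * (1 + m ^+ 2).
have K1 : 2 <= K by rewrite /K; have := sqr_ge0 m; nra.
have lid : lebesgue_measure.-integrable setT (fun x => (x * normal_pdf m s x)%:E).
  apply: (normal_moment_integrable (C := K)) => // x.
  have := sqr_ge0 (x - 2 * m); have := mulr_ge0 (sqr_ge0 m) (sqr_ge0 (x - m)).
  have := sqr_ge0 (x - 1); have := sqr_ge0 (x + 1).
  by rewrite ler_norml; move=> ? ? ? ?; apply/andP; split; rewrite /K; nra.
have lsq : lebesgue_measure.-integrable setT (fun x => (x ^+ 2 * normal_pdf m s x)%:E).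
  apply: (normal_moment_integrable (C := K)) => // x.
  rewrite ger0_norm ?sqr_ge0//.
  have := sqr_ge0 (x - 2 * m); have := mulr_ge0 (sqr_ge0 m) (sqr_ge0 (x - m)).
  by rewrite /K; nra.
have lcos b : lebesgue_measure.-integrable setT (fun x => (cos (x + b) * normal_pdf m s x)%:E).
  apply: (normal_moment_integrable (C := 1)) => // x.
  by rewrite mul1r (le_trans (cos_max _))// lerDl sqr_ge0.
have lw := @integrable_normal_pdf R m s.
have lmw : lebesgue_measure.-integrable setT (fun x => (m * normal_pdf m s x)%:E).
  by have /(integrableZl measurableT m) := lw; apply: eq_integrable.
have [i1 e1] := @transfer_law _ _ _ P (normal_prob m s) Z _ mZ law mid
  (normal_prob_integrable mid lid).
have [i2 e2] := @transfer_law _ _ _ P (normal_prob m s) Z _ mZ law msq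
  (normal_prob_integrable msq lsq).
have E1 : \int[lebesgue_measure]_x (x * normal_pdf m s x) = m.
  have := normal_pdf_moment1 m s0.
  under eq_Rintegral do rewrite mulrBl.
  rewrite RintegralB ?RintegralZl ?Rintegral_normal_pdf//.
  by lra.
split; split => //.
- by rewrite e1 Rintegral_normal_prob.
- rewrite e2 Rintegral_normal_prob//.
  have := normal_pdf_moment2 m s0.
  have -> : \int[lebesgue_measure]_x ((x - m) ^+ 2 * normal_pdf m s x) =
    \int[lebesgue_measure]_x (x ^+ 2 * normal_pdf m s x -
       (2 * m * (x * normal_pdf m s x) - m ^+ 2 * normal_pdf m s x)).
    by apply: eq_Rintegral => x _; ring.
  have j1 : lebesgue_measure.-integrable setT
      (fun x => (2 * m * (x * normal_pdf m s x))%:E).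
    by have /(integrableZl measurableT (2 * m)) := lid; apply: eq_integrable.
  have j2 : lebesgue_measure.-integrable setT
      (fun x => (m ^+ 2 * normal_pdf m s x)%:E).
    by have /(integrableZl measurableT (m ^+ 2)) := lw; apply: eq_integrable.
  rewrite RintegralB//; last by have := integrableB measurableT j1 j2; apply: eq_integrable.
  rewrite RintegralB// !RintegralZl// Rintegral_normal_pdf E1.
  by move=> <-; ring.
- move=> b; have [_ e3] := @transfer_law _ _ _ P (normal_prob m s) Z _ mZ law (mcos b)
    (normal_prob_integrable (mcos b) (lcos b)).
  rewrite e3 Rintegral_normal_prob//.
  have := normal_pdf_cos m (m + b) s0 1; rewrite mulr1 => <-.
  by apply: eq_Rintegral => x _; congr (cos _ * _); ring.
Qed.

(** [is_gaussian] only asserts that some mean and deviation exist. For a linear combination they are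
    found by computing its first two moments from the coordinate means and covariances. *)
Lemma gaussian_vector_law (R : realType) (d : measure_display) (T : measurableType d)
    (P : probability T R) (n : nat) (X : 'I_n -> {RV P >-> R}) (A : 'M[R]_n)
    (a : 'I_n -> R) :
  centered_gaussian_vector X A -> exists s : R,
  [/\ 0 <= s, s ^+ 2 = \sum_i \sum_j a i * a j * A i j,
      forall B : set R, measurable B ->
        P [set w | B (\sum_i a i * X i w)] = gaussian_law 0 s B &
      forall b, \int[P]_w cos (\sum_i a i * X i w + b) =
        expR (- (\sum_i \sum_j a i * a j * A i j) / 2) * cos b].
Proof.
move=> [gX X0 covX].
have mX i : measurable_fun setT (X i) by [].
have gXi i : is_gaussian P (X i).
  have := gX (fun j => (j == i)%:R).
  rewrite (_ : (fun w => _) = X i)//; apply/funext => w.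
  by rewrite (bigD1 i)//= eqxx mul1r big1 ?addr0// => j /negbTE->; rewrite mul0r.
have iX i : P.-integrable setT (EFin \o X i).
  by have [? [? [[_ _ ? ?] _]]] := is_gaussian_facts (mX i) (gXi i).
have iX2 i : P.-integrable setT (EFin \o (fun w => X i w ^+ 2)).
  by have [? [? [[_ _ ? ?] _]]] := is_gaussian_facts (mX i) (gXi i).
have iXX i j : P.-integrable setT (EFin \o (fun w => X i w * X j w)).
  have i2 := integrableD measurableT (iX2 i) (iX2 j).
  apply: (le_integrable measurableT _ _ i2).
    by apply/measurable_EFinP; exact: measurable_funM.
  move=> w _ /=; rewrite lee_fin [leRHS]ger0_norm ?addr_ge0 ?sqr_ge0//.
  rewrite ler_norml; apply/andP; split; nra.
pose Z w := \sum_i a i * X i w.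
have mZ : measurable_fun setT Z.
  by apply: measurable_sum => i; exact: measurable_funM.
have [m [s [[s_ge0 law _ _] [EZ EZ2 Ecos]]]] := is_gaussian_facts mZ (gX a).
have m0 : m = 0.
  rewrite -EZ /Rintegral /Z.
  under eq_integral do rewrite -sumEFin.
  rewrite integral_sum//; last first.
    by move=> i; have /(integrableZl measurableT (a i)) := iX i; apply: eq_integrable.
  rewrite big1// => i _; under eq_integral do rewrite EFinM.
  rewrite integralZl//; last exact: iX.
  by have := X0 i; rewrite unlock => ->; rewrite mule0.
have s2 : s ^+ 2 = \sum_i \sum_j a i * a j * A i j.
  have := EZ2; rewrite m0 expr0n add0r => <-.
  rewrite /Rintegral /Z -[RHS]/(fine (_)%:E); congr fine.
  rewrite pair_big/= -sumEFin.
  transitivity (\int[P]_w \sum_(p : 'I_n * 'I_n) (a p.1 * a p.2)%:E * (X p.1 w * X p.2 w)%:E)%E.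
    apply: eq_integral => w _; under [RHS]eq_bigr do rewrite -EFinM.
    rewrite sumEFin; congr EFin; rewrite expr2.
    transitivity (\sum_i \sum_j (a i * a j) * (X i w * X j w)).
      rewrite mulr_suml; apply: eq_bigr => i _; rewrite mulr_sumr.
      by apply: eq_bigr => j _; ring.
    by rewrite pair_big.
  rewrite integral_sum//; last by move=> p; apply: integrableZl => //; exact: iXX.
  apply: eq_bigr => p _; rewrite integralZl//; last exact: iXX.
  rewrite [in RHS]EFinM; congr (_ * _)%E.
  have := covX p.1 p.2; rewrite unlock !X0/= unlock => <-.
  by apply: eq_integral => w _; rewrite !fctE /= !subr0.
exists s; rewrite -s2; split => // [B mB|b]; first by have := law B mB; rewrite m0.
by rewrite Ecos m0 add0r.
Qed.

(** * The normal tail *)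

(** Written through the distribution function, so that the derivative follows from the fundamental
    theorem with a variable upper endpoint. *)
Definition normal_tail (R : realType) (u : R) : R :=
  1 - \int[lebesgue_measure]_(t in `]-oo, u]) normal_pdf 0 1 t.

Local Notation phi := (normal_pdf 0 1).
Local Notation kappa := (@normal_tail _).

Lemma phi_gt0 (R : realType) (u : R) : 0 < phi u.
Proof. by rewrite normal_pdfE ?oner_eq0// mulr_gt0 ?normal_peak_gt0 ?oner_eq0// expR_gt0. Qed.

Lemma phiE (R : realType) (u : R) : phi u = normal_peak 1 * expR (- u ^+ 2 / 2).
Proof. by rewrite normal_pdfE ?oner_eq0// /normal_fun subr0 expr1n. Qed.

Lemma phiN (R : realType) (u : R) : phi (- u) = phi u.
Proof. by rewrite !phiE sqrrN. Qed.

Lemma phi_le (R : realType) (u v : R) : 0 <= u -> u <= v -> phi v <= phi u.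
Proof.
move=> u0 uv; rewrite !phiE ler_wpM2l ?normal_peak_ge0// ler_expR.
by rewrite ler_pM2r ?invr_gt0// lerN2 lerXn2r// nnegrE (le_trans u0).
Qed.

Lemma normal_prob_cdf (R : realType) (u : R) :
  normal_prob 0 1 `]-oo, u] = (1 - kappa u)%:E.
Proof.
rewrite /normal_tail opprB addrC subrK /Rintegral fineK//.
by apply: (@fin_num_measure _ _ _ (normal_prob 0 (1 : R))); exact: measurable_itv.
Qed.

Lemma normal_prob_cdfo (R : realType) (u : R) :
  normal_prob 0 1 `]-oo, u[ = (1 - kappa u)%:E.
Proof.
rewrite -normal_prob_cdf /normal_prob; apply: integral_itv_bndo_bndc.
by apply/measurable_EFinP; apply: measurable_funTS; exact: measurable_normal_pdf.
Qed.

Lemma normal_prob_ccdf (R : realType) (u : R) :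
  normal_prob 0 1 `[u, +oo[ = (kappa u)%:E.
Proof.
rewrite -setCitvl probability_setC//.
by rewrite [X in (_ - X)%E](normal_prob_cdfo u) -EFinB opprB addrC subrK.
Qed.

Lemma normal_prob_ccdfo (R : realType) (u : R) :
  normal_prob 0 1 `]u, +oo[ = (kappa u)%:E.
Proof.
rewrite -setCitvl probability_setC//.
by rewrite [X in (_ - X)%E](normal_prob_cdf u) -EFinB opprB addrC subrK.
Qed.

Lemma kappa_ge0 (R : realType) (u : R) : 0 <= kappa u.
Proof. by rewrite -lee_fin -normal_prob_ccdf. Qed.

Lemma kappa_le1 (R : realType) (u : R) : kappa u <= 1.
Proof. by rewrite -lee_fin -normal_prob_ccdf probability_le1//; exact: measurable_itv. Qed.

Lemma is_derive_kappa (R : realType) (u : R) :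
  is_derive u (1 : R) (@normal_tail R) (- phi u).
Proof.
have i : lebesgue_measure.-integrable `]-oo, (u + 1)] (EFin \o (phi : R -> R)).
  by apply: (integrableS measurableT) => //; exact: integrable_normal_pdf.
have u1 : u < u + 1 by rewrite ltrDl.
have cphi : {for u, continuous (phi : R -> R)}.
  by apply: continuous_normal_pdf; exact: oner_neq0.
have [|D E] := @continuous_FTC1 R phi (BInfty R true) u (u + 1) u1 i _ cphi; first exact: ltNyr.
have d := DeriveDef D (etrans (esym (derive1E _ _)) E).
have := is_deriveB (is_derive_cst (1 : R) u (1 : R)) d.
by rewrite sub0r.
Qed.

Lemma kappa_continuous (R : realType) : continuous (@normal_tail R).
Proof. exact: (is_derive_continuous (@is_derive_kappa R)). Qed.

Lemma kappa_diff (R : realType) (a b : R) : 0 <= a -> a <= b ->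
  (b - a) * phi b <= kappa a - kappa b <= (b - a) * phi a.
Proof.
move=> a0; rewrite le_eqVlt => /predU1P[->|ab]; first by rewrite !subrr !mul0r lexx.
have [|c cab E] := @MVT R kappa (fun x => - phi x) a b ab (fun x _ => is_derive_kappa x).
  by apply: continuous_subspaceT; exact: kappa_continuous.
move: cab; rewrite in_itv/= => /andP[ac cb].
have -> : kappa a - kappa b = (b - a) * phi c by rewrite -opprB E mulNr opprK mulrC.
have ba0 : 0 <= b - a by rewrite subr_ge0 ltW.
by apply/andP; split; apply: ler_wpM2l => //; apply: phi_le; lra.
Qed.

Lemma kappa_le (R : realType) (a b : R) : a <= b -> kappa b <= kappa a.
Proof.
move=> ab; rewrite -lee_fin -!normal_prob_ccdf le_measure ?inE//=.
by apply: subset_itvr; rewrite bnd_simp.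
Qed.

Lemma ge0_integral_opp (R : realType) (f : R -> \bar R) :
  measurable_fun setT f -> (forall x, (0 <= f x)%E) ->
  (\int[lebesgue_measure]_x f (- x)%R = \int[lebesgue_measure]_x f x)%E.
Proof.
move=> mf f0.
have := @ge0_integral_pushforward _ _ (measurableTypeR R) (measurableTypeR R) R
  -%R (@oppr_measurable R setT) (@lebesgue_measure R) setT f measurableT mf (fun x _ => f0 x).
rewrite preimage_setT => <-; apply: eq_measure_integral => A mA _.
exact: lebesgue_measureN.
Qed.

(** The image of Lebesgue measure under scaling by [a], multiplied by [a], agrees with Lebesgue
    measure on intervals, hence everywhere. *)
Lemma ge0_integral_scale (R : realType) (a : R) (f : R -> \bar R) : 0 < a ->
  measurable_fun setT f -> (forall x, (0 <= f x)%E) ->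
  (\int[lebesgue_measure]_x f x = a%:E * \int[lebesgue_measure]_x f (a * x)%R)%E.
Proof.
move=> a0 mf f0.
have ma : @measurable_fun _ _ (measurableTypeR R) (measurableTypeR R) setT
    (fun x : R => a * x) by exact: measurable_funM.
pose ma_mixin := isMeasurableFun.Build _ _ _ _ _ ma.
pose am : {mfun (measurableTypeR R) >-> (measurableTypeR R)} :=
  HB.pack (fun x : R => a * x) ma_mixin.
have := @ge0_integral_pushforward _ _ (measurableTypeR R) (measurableTypeR R) R
  am ma (@lebesgue_measure R) setT f measurableT mf (fun x _ => f0 x).
rewrite preimage_setT => <-.
pose aa : {nonneg R} := NngNum (ltW a0).
pose push0 : {measure set (measurableTypeR R) -> \bar R} :=
  pushforward (@lebesgue_measure R) am.
pose push := push0 ma.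
rewrite -(@ge0_integral_mscale _ _ _ push setT measurableT aa f mf (fun x _ => f0 x)).
apply: eq_measure_integral => A mA _.
apply: (@lebesgue_measure_unique R (mscale aa push)) => //= _ [[b c]] _ <-.
rewrite /mscale/= /push/push0/= /pushforward/=.
rewrite (_ : _ @^-1` _ = `]b / a, c / a]%classic); last first.
  apply/seteqP; split => x /=; rewrite !in_itv/=.
    by rewrite ltr_pdivrMr// ler_pdivlMr// mulrC.
  by rewrite ltr_pdivrMr// ler_pdivlMr// mulrC.
rewrite !lebesgue_measure_itv/= !lte_fin ltr_pM2r ?invr_gt0//.
case: ifP => _; last by rewrite mule0.
by rewrite -!EFinB -EFinM -mulrBl mulrCA divff ?mulr1// gt_eqF.
Qed.

Lemma normal_prob_opp (R : realType) (B : set R) : measurable B ->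
  normal_prob 0 1 (-%R @^-1` B) = normal_prob (0 : R) 1 B.
Proof.
move=> mB; have mN : measurable (-%R @^-1` B).
  by rewrite -[X in measurable X]setTI; apply: (@oppr_measurable R setT).
rewrite /normal_prob [LHS]integral_mkcond [RHS]integral_mkcond.
rewrite -[RHS]ge0_integral_opp.
- apply: eq_integral => x _; rewrite !patchE phiN.
  by rewrite (_ : (x \in -%R @^-1` B) = (- x \in B))// !inE.
- apply/(measurable_restrictT _ _).1 => //.
  by apply: measurable_funTS; apply/measurable_EFinP; exact: measurable_normal_pdf.
- by move=> x; rewrite patchE; case: ifP => // _; rewrite lee_fin normal_pdf_ge0.
Qed.

Lemma kappaN (R : realType) (u : R) : kappa (- u) = 1 - kappa u.
Proof.
apply/EFin_inj; rewrite -normal_prob_cdf -normal_prob_ccdf -normal_prob_opp//.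
by rewrite opp_preimage_itvbndy opprK.
Qed.

Lemma kappa0 (R : realType) : kappa 0 = 2^-1 :> R.
Proof. by have := kappaN (0 : R); rewrite oppr0; lra. Qed.

Lemma phi_cvg0 (R : realType) : (phi x @[x --> +oo] --> (0 : R)).
Proof.
have [] := @normal_decay R 0 1 1 (cst 1) (oner_neq0 _) _.
  by move=> x; rewrite /= normr1 mul1r lerDl.
by under eq_fun do rewrite /= mul1r.
Qed.

(** Under the integral over [u, oo[ replace the factor u by x >= u; the primitive of x phi(x) is -
    phi(x). *)
Lemma mills_ratio (R : realType) (u : R) : 0 <= u -> u * kappa u <= phi u.
Proof.
move=> u0; have cphi : continuous (phi : R -> R).
  by apply: continuous_normal_pdf; exact: oner_neq0.
have dphi (x : R) : is_derive x (1 : R) (fun x => - phi x) (x * phi x).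
  have := is_deriveN (normal_pdf_derive 0 x (oner_neq0 R)).
  by rewrite subr0 expr1n divr1 mulNr opprK.
have cF : continuous (fun x : R => - phi x) by exact: is_derive_continuous dphi.
have E : (\int[lebesgue_measure]_(x in `[u, +oo[) (x * phi x)%:E =
    (- 0)%:E - (- phi u)%:E)%E.
  apply: (@ge0_continuous_FTC2y _ (fun x => x * phi x) (fun x => - phi x)).
  - by move=> x ux; rewrite mulr_ge0 ?normal_pdf_ge0// (le_trans u0).
  - apply: continuous_subspaceT => x; apply: cvgM; [exact: cvg_id|exact: cphi].
  - by apply: cvgN; exact: phi_cvg0.
  - by move=> x _; case: (dphi x).
  - exact: cvg_at_right_filter (cF u).
  - by move=> x _; rewrite derive1E; case: (dphi x) => _ ->.
have mphi : measurable_fun setT (fun x : R => (phi x)%:E).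
  by apply/measurable_EFinP; exact: measurable_normal_pdf.
have mxphi : measurable_fun setT (fun x : R => (x * phi x)%:E).
  by apply/measurable_EFinP; apply: measurable_funM => //; exact: measurable_normal_pdf.
rewrite -lee_fin EFinM -normal_prob_ccdf /normal_prob -ge0_integralZl//; last 2 first.
  exact: measurable_funTS.
  by move=> x _; rewrite lee_fin normal_pdf_ge0.
have -> : (phi u)%:E = ((- 0)%:E - (- phi u)%:E)%E :> \bar R.
  by rewrite -EFinB opprK oppr0 add0r.
rewrite -E; apply: ge0_le_integral => //.
- by move=> x _; rewrite mule_ge0 ?lee_fin ?normal_pdf_ge0.
- by apply: emeasurable_funM => //; exact: measurable_funTS.
- exact: measurable_funTS.
- move=> x /=; rewrite in_itv/= andbT => ux.
  by rewrite lee_fin ler_wpM2r ?normal_pdf_ge0.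
Qed.

Lemma kappa_cvg0 (R : realType) : (kappa x @[x --> +oo] --> (0 : R)).
Proof.
apply: (@squeeze_cvgr _ _ _ _ (cst 0) phi); last 2 first.
- exact: cvg_cst.
- exact: phi_cvg0.
near=> x; have x1 : 1 <= x by near: x; apply: nbhs_pinfty_ge; exact: num_real.
rewrite /= kappa_ge0/= (le_trans _ (mills_ratio (le_trans ler01 x1)))//.
by rewrite ler_peMl// kappa_ge0.
Unshelve. all: by end_near. Qed.

Lemma derive_le0_le (R : realType) (f f' : R -> R) (a b : R) : a <= b ->
  (forall x, is_derive x (1 : R) f (f' x)) -> (forall x, a <= x <= b -> f' x <= 0) ->
  f b <= f a.
Proof.
rewrite le_eqVlt => /predU1P[->//|ab] df f'0.
have [|c cab E] := @MVT R f f' a b ab (fun x _ => df x).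
  by apply: continuous_subspaceT; exact: is_derive_continuous df.
move: cab; rewrite in_itv/= => /andP[ac cb].
by rewrite -subr_le0 E mulr_le0_ge0 ?subr_ge0 ?(ltW ab)// f'0// !ltW.
Qed.

(* [|N|] has an increasing hazard rate, hence is new better than used:
   P(|N| > 2 u) <= P(|N| > u)^2 *)
Lemma kappa_double (R : realType) (u : R) : 0 <= u -> kappa (2 * u) <= 2 * kappa u ^+ 2.
Proof.
move=> u0; pose r x : R := kappa (u + x) - 2 * kappa u * kappa x.
pose r' x : R := - phi (u + x) + 2 * kappa u * phi x.
have dr x : is_derive x (1 : R) r (r' x).
  have d0 : is_derive x (1 : R) (fun x => u + x) 1.
    by have := is_deriveD (is_derive_cst u x (1 : R)) (is_derive_id x (1 : R)); rewrite add0r.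
  have d1 := @is_derive1_comp R (@normal_tail R) _ _ _ _ (is_derive_kappa _) d0.
  have d2 := is_deriveZ (2 * kappa u) (is_derive_kappa x).
  have := is_deriveB d1 d2.
  by rewrite mulr1 /GRing.scale/= mulrN opprK.
have r'E x : r' x = phi x * (2 * kappa u - expR (- (u * x) - u ^+ 2 / 2)).
  rewrite /r' !phiE (_ : - (u + x) ^+ 2 / 2 =
     - x ^+ 2 / 2 + (- (u * x) - u ^+ 2 / 2)); last by field.
  by rewrite expRD; ring.
have r0 : r 0 = 0 by rewrite /r addr0 kappa0; field.
suff : r u <= 0 by rewrite /r (_ : u + u = 2 * u); [lra|ring].
(* The bracket in [r'E] is nondecreasing in x. If it is nonpositive at x = u, then r decreases on
   [0, u] from r(0) = 0. Otherwise r increases on [u, oo[ while staying below kappa(x), which tends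
   to 0. Either way r(u) <= 0. *)
have [H|H] := leP (2 * kappa u) (expR (- (u * u) - u ^+ 2 / 2)).
  rewrite -r0; apply: (derive_le0_le u0 dr) => x /andP[x0 xu].
  rewrite r'E pmulr_rle0 ?phi_gt0// subr_le0 (le_trans H)// ler_expR.
  by rewrite lerD2r lerN2 ler_wpM2l.
have mono x : u <= x -> r u <= r x.
  move=> ux; rewrite -lerN2.
  have dN y : is_derive y (1 : R) (fun y => - r y) (- r' y) by exact: is_deriveN.
  apply: (derive_le0_le ux dN) => y /andP[uy _].
  rewrite oppr_le0 r'E mulr_ge0 ?normal_pdf_ge0// subr_ge0 (le_trans _ (ltW H))//.
  by rewrite ler_expR lerD2r lerN2 ler_wpM2l.
apply/ler_addgt0Pr => e e0; rewrite add0r.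
have : \forall x \near +oo, kappa x < e.
  by have := @kappa_cvg0 R; move/cvgr_lt; apply.
move=> H1; near (pinfty_nbhs R) => x.
apply: (le_trans (mono x _)); first by near: x; apply: nbhs_pinfty_ge; exact: num_real.
apply: (@le_trans _ _ (kappa (u + x))).
  by rewrite /r lerBlDr lerDl mulr_ge0 ?kappa_ge0// mulr_ge0 ?kappa_ge0.
apply: (@le_trans _ _ (kappa x)); first by apply: kappa_le; rewrite lerDr.
by apply: ltW; near: x.
Unshelve. all: by end_near. Qed.

(** The integrand is the derivative of - kappa^2 / 2, and kappa(0) = 1/2. *)
Lemma integral_kappa_phi (R : realType) :
  (\int[lebesgue_measure]_(x in `[0%R, +oo[) (kappa x * phi x)%:E = (8^-1 : R)%:E)%E.
Proof.
have cphi : continuous (phi : R -> R).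
  by apply: continuous_normal_pdf; exact: oner_neq0.
have dF (x : R) : is_derive x (1 : R) (fun x => - (2^-1 * kappa x ^+ 2)) (kappa x * phi x).
  have dk := is_derive_kappa x.
  have d := is_deriveN (is_deriveZ 2^-1 (is_deriveM dk dk)).
  apply: is_derive_eq d _; rewrite /GRing.scale/=.
  by rewrite /GRing.scale/=; field.
have cF := is_derive_continuous dF.
rewrite (@ge0_continuous_FTC2y _ (fun x => kappa x * phi x)
   (fun x => - (2^-1 * kappa x ^+ 2)) 0 0).
- by rewrite -EFinB kappa0; congr EFin; field.
- by move=> x _; rewrite mulr_ge0 ?kappa_ge0 ?normal_pdf_ge0.
- apply: continuous_subspaceT => x; apply: cvgM; last exact: cphi.
  exact: kappa_continuous.
- have c : - (2^-1 * (kappa x * kappa x)) @[x --> +oo] --> - (2^-1 * (0 * 0) : R).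
    apply: cvgN; apply: cvgM; first exact: cvg_cst.
    by apply: cvgM; exact: kappa_cvg0.
  rewrite !mulr0 oppr0 in c.
  by rewrite (_ : (fun x => _) = (fun x => - (2^-1 * (kappa x * kappa x)))).
- by move=> x _; case: (dF x).
- exact: cvg_at_right_filter (cF 0).
- by move=> x _; rewrite derive1E; case: (dF x) => _ ->.
Qed.

Lemma normal_prob_cos (R : realType) (m s t e : R) : s != 0 ->
  \int[normal_prob m s]_x cos (t * x + e) = expR (- (s * t) ^+ 2 / 2) * cos (t * m + e).
Proof.
move=> s0; have mcos : measurable_fun setT (fun x : R => cos (t * x + e)).
  by apply: (measurableT_comp (@measurable_cos R)); apply: measurable_funD => //;
    exact: measurable_funM.
rewrite Rintegral_normal_prob//; last first.
  apply: (normal_moment_integrable (C := 1)) => // x.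
  by rewrite mul1r (le_trans (cos_max _))// lerDl sqr_ge0.
rewrite -(normal_pdf_cos m (t * m + e) s0 t).
by apply: eq_Rintegral => x _; congr (cos _ * _); ring.
Qed.

Lemma Rintegral_prod (R : realType) (d1 d2 : measure_display)
    (T1 : measurableType d1) (T2 : measurableType d2) (P1 : probability T1 R)
    (P2 : probability T2 R) (g : T1 * T2 -> R) (M : R) :
  measurable_fun setT g -> (forall z, `|g z| <= M) ->
  \int[(P1 \x P2)%E]_z g z = \int[P1]_x \int[P2]_y g (x, y).
Proof.
move=> mg gM.
have ig := @bounded_integrable _ _ _ (P1 \x P2)%E g M mg gM.
rewrite {1}/Rintegral -integral12_prod_meas1//; congr fine.
apply: eq_integral => x _; rewrite /fubini_F /= fineK//.
apply: integrable_fin_num => //; apply: (bounded_integrable P2 (M := M)) => //.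
by apply: measurableT_comp => //; exact: measurable_pair1.
Qed.

(** * The model with independent coordinates *)

Section model.
Context (R : realType) (h s m sigma : R) (sigma0 : sigma != 0).

Definition tetra_prob : probability (measurableTypeR R *
    (measurableTypeR R * measurableTypeR R))%type R :=
  (normal_prob m sigma \x (normal_prob 0 1 \x normal_prob 0 1))%E.

Definition tetra_coord (i : 'I_4) (z : measurableTypeR R *
    (measurableTypeR R * measurableTypeR R)) : R :=
  h + s * (z.1 + nth 0 [:: z.2.1; z.2.2; - z.2.1; - z.2.2] i).

Lemma measurable_tetra_coord i : measurable_fun setT (tetra_coord i).
Proof.
move: i; apply: ord4P; rewrite /tetra_coord/=;
  apply: measurable_funD => //; apply: measurable_funM => //;
  apply: measurable_funD => //.
- exact: (measurableT_comp measurable_fst measurable_snd).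
- exact: (measurableT_comp measurable_snd measurable_snd).
- apply: measurable_funN.
  exact: (measurableT_comp measurable_fst measurable_snd).
- apply: measurable_funN.
  exact: (measurableT_comp measurable_snd measurable_snd).
Qed.

(** Opposite coordinates contain the same V with opposite signs, so only the sum of [a] and the
    differences a0 - a2, a1 - a3 enter. The three variables are integrated out one at a time. *)
Lemma tetra_cos (a : 'I_4 -> R) (b : R) :
  \int[tetra_prob]_z cos (\sum_i a i * tetra_coord i z + b) =
  expR (- ((sigma * (s * \sum_i a i)) ^+ 2 + (s * (a o0 - a o2)) ^+ 2
           + (s * (a o1 - a o3)) ^+ 2) / 2)
  * cos (\sum_i a i * (h + s * m) + b).
Proof.
pose A := \sum_i a i; pose B := s * (a o0 - a o2); pose C := s * (a o1 - a o3).
have E z : cos (\sum_i a i * tetra_coord i z + b) =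
    cos (s * A * z.1 + (B * z.2.1 + (C * z.2.2 + (A * h + b)))).
  by congr cos; rewrite /A !big_ord4 /tetra_coord/= /B /C; ring.
have mc (f : measurableTypeR R * (measurableTypeR R * measurableTypeR R) -> R) :
    measurable_fun setT f -> measurable_fun setT (cos \o f).
  by move=> mf; exact: (measurableT_comp (@measurable_cos R)).
under eq_Rintegral do rewrite E.
rewrite (Rintegral_prod _ _ (M := 1)); last 2 first.
  apply: (measurableT_comp (@measurable_cos R)).
  apply: measurable_funD; first exact: measurable_funM.
  apply: measurable_funD.
    by apply: measurable_funM => //; exact: (measurableT_comp measurable_fst measurable_snd).
  apply: measurable_funD => //.
  by apply: measurable_funM => //; exact: (measurableT_comp measurable_snd measurable_snd).
  by move=> z; exact: cos_max.
have inner x : \int[(normal_prob 0 1 \x normal_prob 0 1)%E]_y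
    cos (s * A * x + (B * y.1 + (C * y.2 + (A * h + b)))) =
    expR (- B ^+ 2 / 2) * expR (- C ^+ 2 / 2) * cos (s * A * x + (A * h + b)).
  rewrite (Rintegral_prod _ _ (M := 1)); last 2 first.
    apply: (measurableT_comp (@measurable_cos R)).
    apply: measurable_funD => //; apply: measurable_funD.
      exact: measurable_funM.
    by apply: measurable_funD => //; exact: measurable_funM.
    by move=> z; exact: cos_max.
  transitivity (\int[normal_prob 0 1]_y (expR (- C ^+ 2 / 2) *
      cos (B * y + (s * A * x + (A * h + b))))).
    apply: eq_Rintegral => y _ /=.
    have := @normal_prob_cos R 0 1 C (s * A * x + (B * y + (A * h + b))) (oner_neq0 _).
    rewrite mul1r mulr0 add0r.
    rewrite (_ : B * y + (s * A * x + (A * h + b)) =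
      s * A * x + (B * y + (A * h + b))); last by ring.
    move=> <-; apply: eq_Rintegral => v _; congr cos; ring.
  rewrite RintegralZl//; last first.
    apply: (bounded_integrable (normal_prob 0 (1 : R)) (M := 1)); last by move=> ?; exact: cos_max.
    apply: (measurableT_comp (@measurable_cos R)).
    by apply: measurable_funD => //; exact: measurable_funM.
  by rewrite normal_prob_cos ?oner_neq0// mulr0 add0r mul1r mulrA (mulrC (expR _)).
under eq_Rintegral do rewrite inner.
rewrite RintegralZl//; last first.
  apply: (bounded_integrable (normal_prob m sigma) (M := 1)); last by move=> ?; exact: cos_max.
  apply: (measurableT_comp (@measurable_cos R)).
  by apply: measurable_funD => //; exact: measurable_funM.
rewrite normal_prob_cos// mulrA -!expRD -mulr_suml; congr (expR _ * cos _).
  by rewrite -/A -/B -/C; field.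
by rewrite -/A; ring.
Qed.

End model.

(* Given [U = u], the values of [V] for which the signs of [U + V] and [U - V]
   are [b] and [b']. *)
Definition slab (R : realType) (u : R) (b b' : bool) : set R :=
  [set v | (0 < u + v) = b /\ (0 < u - v) = b'].

Lemma slabP (R : realType) (u v : R) (b b' : bool) : slab u b b' v <->
  (if b then - u < v else v <= - u) /\ (if b' then v < u else u <= v).
Proof.
rewrite /slab/= -ltrBlDl sub0r subr_gt0; case: b; case: b'; split=> -[h1 h2]; split => //.
all: by [rewrite leNgt ?h1 ?h2|apply/negbTE; rewrite -leNgt].
Qed.

Lemma normal_prob_setD (R : realType) (A B : set R) (a b : R) :
  measurable A -> measurable B -> A `<=` B ->
  normal_prob 0 1 A = a%:E -> normal_prob 0 1 B = b%:E ->
  normal_prob 0 1 (B `\` A) = (b - a)%:E.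
Proof.
move=> mA mB AB Na Nb; rewrite measureD ?setIidr//; last first.
  exact: (eq_ind_r (fun x => (x < +oo)%E) (ltry b) Nb).
rewrite EFinB -Na -Nb//.
Qed.

(** Up to ties, U + V and U - V have equal signs iff |V| < |u|, and the common sign is then that of
    u. They differ iff |V| > |u|, in either order with probability kappa |u|. *)
Lemma slab_prob (R : realType) (u : R) (b b' : bool) :
  normal_prob 0 1 (slab u b b') =
  (match b, b' with
   | true, true => if 0 < u then 1 - 2 * kappa `|u| else 0
   | false, false => if 0 < u then 0 else 1 - 2 * kappa `|u|
   | _, _ => kappa `|u| end)%:E.
Proof.
have kN := kappaN u.
have [u0|u0] := ltP 0 u.
  rewrite (gtr0_norm u0).
  have -> : slab u b b' = match b, b' with
      | true, true => `]-oo, u[%classic `\` `]-oo, (- u)]%classic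
      | true, false => `[u, +oo[%classic
      | false, true => `]-oo, (- u)]%classic
      | false, false => set0 end.
    apply/seteqP; split=> v; rewrite slabP; case: b; case: b' => /=;
      rewrite ?in_itv/= ?andbT.
    - by move=> [h1 h2]; split=> //; apply/negP; rewrite -ltNge.
    - by case.
    - by case.
    - by move=> [h1 h2]; lra.
    - by move=> [h1 /negP]; rewrite -ltNge.
    - by move=> h1; split => //; lra.
    - by move=> h1; split => //; lra.
    - by [].
  case: b; case: b'.
  - rewrite (normal_prob_setD _ _ _ (normal_prob_cdf _) (normal_prob_cdfo _))//.
      by congr EFin; rewrite kN; ring.
    by apply: subset_itvl; rewrite bnd_simp; lra.
  - exact: normal_prob_ccdf.
  - by rewrite normal_prob_cdf kN; congr EFin; ring.
  - exact: measure0.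
rewrite (ler0_norm u0).
have -> : slab u b b' = match b, b' with
    | true, true => set0
    | true, false => `](- u), +oo[%classic
    | false, true => `]-oo, u[%classic
    | false, false => `]-oo, (- u)]%classic `\` `]-oo, u[%classic end.
  apply/seteqP; split=> v; rewrite slabP; case: b; case: b' => /=;
    rewrite ?in_itv/= ?andbT.
  - by move=> [h1 h2]; lra.
  - by case.
  - by case.
  - by move=> [h1 h2]; split=> //; apply/negP; rewrite -leNgt.
  - by [].
  - by move=> h1; split => //; lra.
  - by move=> h1; split => //; lra.
  - by move=> [h1 /negP]; rewrite -leNgt.
case: b; case: b'.
- exact: measure0.
- exact: normal_prob_ccdfo.
- by rewrite normal_prob_cdfo kN; congr EFin; ring.
- rewrite (normal_prob_setD _ _ _ (normal_prob_cdfo _) (normal_prob_cdf _))//.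
    by congr EFin; rewrite kN; ring.
  by apply: subset_itvl; rewrite bnd_simp; lra.
Qed.

Lemma measurable_slab (R : realType) (u : R) (b b' : bool) : measurable (slab u b b').
Proof.
have -> : slab u b b' = [set` if b then `](- u), +oo[ else `]-oo, (- u)]] `&`
    [set` if b' then `]-oo, u[ else `[u, +oo[].
  by apply/seteqP; split=> v; rewrite slabP; case: b; case: b';
    rewrite /= !in_itv/= ?andbT.
by apply: measurableI; exact: measurable_itv.
Qed.

Lemma tetra_section (R : realType) (h s m sigma : R) (y0 y1 y2 y3 : bool) : 0 < s ->
  tetra_prob m sigma
    [set z | forall i, (h < tetra_coord h s i z) = pat y0 y1 y2 y3 i] =
  (\int[normal_prob m sigma]_u
    (normal_prob 0 1 (slab u y0 y2) * normal_prob 0 1 (slab u y1 y3)))%E.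
Proof.
move=> s0; rewrite /tetra_prob/= /product_measure1; apply: eq_integral => u _ /=.
rewrite -product_measure1E; last 2 first.
- exact: measurable_slab.
- exact: measurable_slab.
congr (product_measure1 _ _ _); apply/seteqP; split=> -[v1 v2]; rewrite /xsection/= ?inE/=.
  move=> H; split; split; [have := H o0|have := H o2|have := H o1|have := H o3];
    by rewrite /tetra_coord ffunE/= ltrDl pmulr_rgt0.
move=> [[h0 h2] [h1 h3]]; apply: ord4P; rewrite /tetra_coord ffunE/= ltrDl pmulr_rgt0//.
Qed.

(** A rotation exchanges the two opposite pairs and reverses one of them, and the probability of a
    slab is symmetric in its two signs. *)
Lemma tetra_rotation (R : realType) (h s m sigma : R) (y0 y1 y2 y3 : bool) : 0 < s ->
  tetra_prob m sigma
    [set z | forall i, (h < tetra_coord h s i z) = pat y0 y1 y2 y3 i] =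
  tetra_prob m sigma
    [set z | forall i, (h < tetra_coord h s i z) = pat y3 y0 y1 y2 i].
Proof.
move=> s0; rewrite (tetra_section _ _ _ y0 y1 y2 y3 s0).
rewrite (tetra_section _ _ _ y3 y0 y1 y2 s0); apply: eq_integral => u _.
by rewrite !slab_prob muleC; case: y3; case: y1.
Qed.

Lemma tetra_pattern (R : realType) (h s m sigma : R) (y0 y1 y2 y3 : bool)
    (f : R -> R) : 0 < s -> measurable_fun setT f -> (forall u, 0 <= f u) ->
  (forall u, normal_prob 0 1 (slab u y0 y2) * normal_prob 0 1 (slab u y1 y3)
    = (f u)%:E)%E ->
  fine (tetra_prob m sigma
    [set z | forall i, (h < tetra_coord h s i z) = pat y0 y1 y2 y3 i]) =
  \int[lebesgue_measure]_u (f u * normal_pdf m sigma u).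
Proof.
move=> s0 mf f0 Hf; rewrite tetra_section// /Rintegral; congr fine.
transitivity (\int[normal_prob m sigma]_u (f u)%:E)%E.
  by apply: eq_integral => u _; rewrite -Hf.
by rewrite ge0_integral_normal_prob//; exact/measurable_EFinP.
Qed.

(** * Inequalities between the orthant integrals *)

Section real_integrable.
Context (R : realType) (d : measure_display) (T : measurableType d)
  (mu : {measure set T -> \bar R}).

Lemma integrable_addR (f g : T -> R) :
  mu.-integrable setT (fun x => (f x)%:E) -> mu.-integrable setT (fun x => (g x)%:E) ->
  mu.-integrable setT (fun x => (f x + g x)%:E).
Proof. by move=> fi gi; have := integrableD measurableT fi gi; apply: eq_integrable. Qed.

Lemma integrable_subR (f g : T -> R) :
  mu.-integrable setT (fun x => (f x)%:E) -> mu.-integrable setT (fun x => (g x)%:E) ->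
  mu.-integrable setT (fun x => (f x - g x)%:E).
Proof. by move=> fi gi; have := integrableB measurableT fi gi; apply: eq_integrable. Qed.

Lemma integrable_scaleR (k : R) (f : T -> R) :
  mu.-integrable setT (fun x => (f x)%:E) ->
  mu.-integrable setT (fun x => (k * f x)%:E).
Proof.
by move=> fi; have /(integrableZl measurableT k) := fi; apply: eq_integrable.
Qed.

End real_integrable.

Section lebesgue_Rintegral.
Context (R : realType) (f g : R -> R).
Hypothesis fi : (@lebesgue_measure R).-integrable setT (fun x => (f x)%:E).

Lemma lebesgue_intZ (k : R) : \int[lebesgue_measure]_x (k * f x) =
  k * \int[lebesgue_measure]_x f x.
Proof. exact: (RintegralZl k measurableT fi). Qed.

Hypothesis gi : (@lebesgue_measure R).-integrable setT (fun x => (g x)%:E).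

Lemma lebesgue_intD : \int[lebesgue_measure]_x (f x + g x) =
  \int[lebesgue_measure]_x f x + \int[lebesgue_measure]_x g x.
Proof. exact: (RintegralD measurableT fi gi). Qed.

Lemma lebesgue_intB : \int[lebesgue_measure]_x (f x - g x) =
  \int[lebesgue_measure]_x f x - \int[lebesgue_measure]_x g x.
Proof. exact: (RintegralB measurableT fi gi). Qed.

Lemma lebesgue_int_le : (forall x : R, f x <= g x) ->
  \int[lebesgue_measure]_x f x <= \int[lebesgue_measure]_x g x.
Proof. by move=> fg; apply: (le_Rintegral measurableT fi gi) => x _; exact: fg. Qed.

End lebesgue_Rintegral.

Lemma Rintegral_opp (R : realType) (f : R -> R) :
  measurable_fun setT f -> (forall x, 0 <= f x) ->
  \int[lebesgue_measure]_x f (- x) = \int[lebesgue_measure]_x f x.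
Proof.
move=> mf f0; rewrite /Rintegral; congr fine.
by rewrite -(@ge0_integral_opp _ (fun x => (f x)%:E))//; exact/measurable_EFinP.
Qed.

Lemma Rintegral_scale (R : realType) (a : R) (f : R -> R) : 0 < a ->
  measurable_fun setT f -> (forall x, 0 <= f x) ->
  \int[lebesgue_measure]_x f x = a * \int[lebesgue_measure]_x f (a * x).
Proof.
move=> a0 mf f0; rewrite /Rintegral.
rewrite (@ge0_integral_scale _ a (fun x => (f x)%:E))//; last exact/measurable_EFinP.
case: (\int[lebesgue_measure]_x (f (a * x))%:E)%E => [r //||].
- by rewrite gt0_muley ?lte_fin//= mulr0.
- by rewrite gt0_muleNy ?lte_fin//= mulr0.
Qed.

Lemma bounded_normal_pdf_integrable (R : realType) (m sigma M : R) (g : R -> R) :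
  sigma != 0 -> measurable_fun setT g -> (forall x, `|g x| <= M) ->
  lebesgue_measure.-integrable setT (fun x => (g x * normal_pdf m sigma x)%:E).
Proof.
move=> s0 mg gM; apply: (normal_moment_integrable (C := M)) => // x.
rewrite (le_trans (gM x))// ler_peMr ?lerDl ?sqr_ge0//.
exact: le_trans (normr_ge0 _) (gM x).
Qed.

Section orthants.
Context (R : realType).

Definition two_tail (u : R) : R := normal_tail `|u|.

Definition step (u : R) : R := if 0 < u then 1 else 0.

Local Notation kap := two_tail.

Lemma two_tail_ge0 (u : R) : 0 <= kap u. Proof. exact: kappa_ge0. Qed.

Lemma two_tail_le (u : R) : kap u <= 2^-1.
Proof. by rewrite -kappa0; exact: kappa_le. Qed.

Lemma two_tailN (u : R) : kap (- u) = kap u. Proof. by rewrite /kap normrN. Qed.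

Lemma measurable_two_tail : measurable_fun setT kap.
Proof.
apply: (measurableT_comp (f := @normal_tail R)) => //.
by apply: continuous_measurable_fun; exact: kappa_continuous.
Qed.

Lemma measurable_step : measurable_fun setT step.
Proof.
rewrite (_ : step = \1_`]0, +oo[); first exact: measurable_indic.
apply/funext => u; rewrite indicE /step; case: ifP => u0.
  by rewrite mem_set//= in_itv/= u0.
by rewrite memNset//= in_itv/= u0.
Qed.

Lemma step_ge0 (u : R) : 0 <= step u. Proof. by rewrite /step; case: ifP. Qed.
Lemma step_le1 (u : R) : step u <= 1. Proof. by rewrite /step; case: ifP. Qed.

(** Given U = u: one opposite pair has equal signs and the other has different signs in a prescribed
    order. *)
Definition mid_tail (u : R) : R := (1 - 2 * kap u) * kap u.

Lemma mid_tail_ge0 (u : R) : 0 <= mid_tail u.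
Proof. by have := two_tail_ge0 u; have := two_tail_le u; rewrite /mid_tail; nra. Qed.

Lemma mid_tail_le (u : R) : mid_tail u <= kap u.
Proof. by have := two_tail_ge0 u; have := two_tail_le u; rewrite /mid_tail; nra. Qed.

Lemma mid_tailN (u : R) : mid_tail (- u) = mid_tail u.
Proof. by rewrite /mid_tail two_tailN. Qed.

Lemma measurable_mid_tail : measurable_fun setT mid_tail.
Proof.
apply: measurable_funM; last exact: measurable_two_tail.
by apply: measurable_funB => //; apply: measurable_funM => //; exact: measurable_two_tail.
Qed.

(** These are n3, n1, n2 of the overview, as integrals against the density of U; the digit counts
    the ones in the pattern. *)
Definition orthant3 (m sigma : R) : R :=
  \int[lebesgue_measure]_u (step u * mid_tail u * normal_pdf m sigma u).
Definition orthant1 (m sigma : R) : R :=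
  \int[lebesgue_measure]_u ((1 - step u) * mid_tail u * normal_pdf m sigma u).
Definition orthant2 (m sigma : R) : R :=
  \int[lebesgue_measure]_u (kap u ^+ 2 * normal_pdf m sigma u).

Context (m sigma : R) (m0 : m <= 0) (sigma0 : 0 < sigma).
Local Notation w := (normal_pdf m sigma).

Let sn0 : sigma != 0. Proof. by rewrite gt_eqF. Qed.

Let wE (u : R) : w u = normal_peak sigma * expR (- (u - m) ^+ 2 / (sigma ^+ 2 *+ 2)).
Proof. by rewrite normal_pdfE. Qed.

Lemma normal_pdf_le (u v : R) : `|u - m| <= `|v - m| -> w v <= w u.
Proof.
move=> uv; rewrite !wE ler_wpM2l ?normal_peak_ge0// ler_expR.
rewrite ler_pM2r ?invr_gt0 ?pmulrn_lgt0 ?exprn_gt0// lerN2.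
by rewrite -(real_normK (num_real (u - m))) -(real_normK (num_real (v - m))) lerXn2r ?nnegrE.
Qed.

(** Brings n1 to the same half-line u > 0 as n3, so that the two differ only in w(-u) against w(u),
    and w(u) <= w(-u) because m <= 0. *)
Lemma orthant1E : orthant1 m sigma =
  \int[lebesgue_measure]_u (step u * mid_tail u * w (- u)).
Proof.
rewrite /orthant1 -Rintegral_opp; last 2 first.
- apply: measurable_funM; last exact: measurable_normal_pdf.
  apply: measurable_funM; last exact: measurable_mid_tail.
  by apply: measurable_funB => //; exact: measurable_step.
- move=> u; rewrite mulr_ge0 ?normal_pdf_ge0// mulr_ge0 ?mid_tail_ge0// subr_ge0.
  exact: step_le1.
apply: eq_Rintegral => u _; rewrite mid_tailN; congr (_ * _).
rewrite /step; case: (ltrgtP u 0) => u0.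
- by rewrite oppr_gt0 u0 subrr.
- by rewrite oppr_gt0 ltNge (ltW u0)/= subr0.
(* At 0 the two indicators disagree, but [mid_tail] vanishes there since kappa(0) = 1/2. *)
- rewrite u0 oppr0 ltxx /mid_tail /kap normr0 kappa0.
  by rewrite mulfV ?pnatr_eq0// subrr !mul0r !mulr0.
Qed.

Let wN_integrable (g : R -> R) (M : R) : measurable_fun setT g -> (forall x, `|g x| <= M) ->
  lebesgue_measure.-integrable setT (fun x => (g x * w (- x))%:E).
Proof.
move=> mg gM; have wN x : w (- x) = normal_pdf (- m) sigma x.
  rewrite wE (normal_pdfE _ sn0) /normal_fun.
  by rewrite (_ : (- x - m) ^+ 2 = (x - - m) ^+ 2)//; ring.
under eq_fun do rewrite wN.
exact: (bounded_normal_pdf_integrable _ (M := M)).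
Qed.

Let step_bound (g : R -> R) (u : R) : 0 <= g u <= 1 -> `|step u * g u| <= 1.
Proof.
move=> /andP[g0 g1]; rewrite ger0_norm ?mulr_ge0 ?step_ge0//.
by rewrite (le_trans _ g1)// ler_piMl// step_le1.
Qed.

Let mid01 (u : R) : 0 <= mid_tail u <= 1.
Proof.
rewrite mid_tail_ge0 (le_trans (mid_tail_le u))// (le_trans (two_tail_le u))//.
lra.
Qed.

Let kap01 (u : R) : 0 <= kap u <= 1.
Proof. by rewrite two_tail_ge0 (le_trans (two_tail_le u))//; lra. Qed.

Let mstep (g : R -> R) : measurable_fun setT g -> measurable_fun setT (fun u : R => step u * g u).
Proof. by move=> mg; apply: measurable_funM => //; exact: measurable_step. Qed.

Let pdf_reflect (u : R) : 0 < u -> w u <= w (- u).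
Proof.
have hm := m0; move=> u0; apply: normal_pdf_le.
rewrite [leRHS]ger0_norm ?ler_norml; last by lra.
by apply/andP; split; lra.
Qed.

Let pdf_double (u : R) : 0 < u -> w (2 * u) <= w u.
Proof.
have hm := m0; move=> u0; apply: normal_pdf_le.
rewrite [leRHS]ger0_norm ?ler_norml; last by lra.
by apply/andP; split; lra.
Qed.

Lemma orthant3_le1 : orthant3 m sigma <= orthant1 m sigma.
Proof.
have hm := m0.
have i3 : lebesgue_measure.-integrable setT (fun u : R => (step u * mid_tail u * w u)%:E).
  apply: (bounded_normal_pdf_integrable _ (M := 1)) => // [|u].
    by apply: mstep; exact: measurable_mid_tail.
  by apply: step_bound; exact: mid01.
have i1 : lebesgue_measure.-integrable setT (fun u : R => (step u * mid_tail u * w (- u))%:E).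
  apply: (wN_integrable (M := 1)) => [|u].
    by apply: mstep; exact: measurable_mid_tail.
  by apply: step_bound; exact: mid01.
rewrite orthant1E; apply: (lebesgue_int_le i3 i1) => u.
rewrite /step; case: ifPn => u0; last by rewrite !mul0r.
by apply: ler_wpM2l (pdf_reflect u0); rewrite mul1r mid_tail_ge0.
Qed.

Let stepD (u : R) : step u + step (- u) <= 1.
Proof. by rewrite /step oppr_gt0; case: (ltrgtP u 0); rewrite ?addr0 ?add0r. Qed.

(** With A and B the integrals of k w and k^2 w over u > 0, n3 = A - 2B, while reflection gives 2B
    <= n2. So A <= 4B is enough: substituting 2u, A is twice the integral of k(2u) w(2u), where
    w(2u) <= w(u) and k(2u) <= 2 k(u)^2. *)
Lemma orthant3_le2 : orthant3 m sigma <= orthant2 m sigma.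
Proof.
have hm := m0.
pose A := \int[lebesgue_measure]_u (step u * kap u * w u).
pose B := \int[lebesgue_measure]_u (step u * kap u ^+ 2 * w u).
have mk2 : measurable_fun setT (fun u : R => kap u ^+ 2).
  by apply: measurable_funX; exact: measurable_two_tail.
have k2_01 u : 0 <= kap u ^+ 2 <= 1.
  by have /andP[a b] := kap01 u; rewrite sqr_ge0 exprn_ile1.
have mk (d : R) : measurable_fun setT (fun u : R => kap (d * u)).
  by apply: (measurableT_comp measurable_two_tail); exact: measurable_funM.
have iA : lebesgue_measure.-integrable setT (fun u : R => (step u * kap u * w u)%:E).
  apply: (bounded_normal_pdf_integrable _ (M := 1)) => // [|u].
    by apply: mstep; exact: measurable_two_tail.
  by apply: step_bound; exact: kap01.
have iB : lebesgue_measure.-integrable setT (fun u : R => (step u * kap u ^+ 2 * w u)%:E).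
  apply: (bounded_normal_pdf_integrable _ (M := 1)) => // [|u]; first exact: mstep.
  exact: (step_bound (g := fun u => kap u ^+ 2)).
have iBN : lebesgue_measure.-integrable setT (fun u : R => (step u * kap u ^+ 2 * w (- u))%:E).
  apply: (wN_integrable (M := 1)) => [|u]; first exact: mstep.
  exact: (step_bound (g := fun u => kap u ^+ 2)).
have iC : lebesgue_measure.-integrable setT
    (fun u : R => (step (- u) * kap u ^+ 2 * w u)%:E).
  apply: (bounded_normal_pdf_integrable _ (M := 1)) => // [|u].
    by apply: measurable_funM => //; apply: (measurableT_comp measurable_step).
  rewrite -(two_tailN u).
  by apply: (step_bound (g := fun u => kap u ^+ 2)); exact: k2_01.
have E3 : orthant3 m sigma = A - 2 * B.
  rewrite /orthant3 -RintegralZl// -RintegralB//.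
    by apply: eq_Rintegral => u _; rewrite /mid_tail; ring.
  exact: (integrable_scaleR 2 iB).
have E2 : 2 * B <= orthant2 m sigma.
  have C : \int[lebesgue_measure]_u (step (- u) * kap u ^+ 2 * w u) =
      \int[lebesgue_measure]_u (step u * kap u ^+ 2 * w (- u)).
    rewrite -Rintegral_opp; last 2 first.
    - apply: measurable_funM; last exact: measurable_normal_pdf.
      by apply: measurable_funM => //; apply: (measurableT_comp measurable_step).
    - by move=> u; rewrite mulr_ge0 ?normal_pdf_ge0// mulr_ge0 ?step_ge0 ?sqr_ge0.
    by apply: eq_Rintegral => u _; rewrite opprK two_tailN.
  have BC : B <= \int[lebesgue_measure]_u (step u * kap u ^+ 2 * w (- u)).
    apply: (lebesgue_int_le iB iBN) => u.
    rewrite /step; case: ifPn => u0; last by rewrite !mul0r.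
    by apply: ler_wpM2l (pdf_reflect u0); rewrite mul1r sqr_ge0.
  apply: (@le_trans _ _ (B + \int[lebesgue_measure]_u (step (- u) * kap u ^+ 2 * w u))).
    by rewrite C mulrDl mul1r lerD2l.
  have iK : lebesgue_measure.-integrable setT (fun u : R => (kap u ^+ 2 * w u)%:E).
    apply: (bounded_normal_pdf_integrable _ (M := 1)) => // u.
    by have /andP[k1 k2] := k2_01 u; rewrite ger0_norm.
  rewrite /B -(lebesgue_intD iB iC).
  apply: (lebesgue_int_le (integrable_addR iB iC) iK) => u.
  rewrite -mulrDl; apply: (ler_wpM2r (normal_pdf_ge0 _ _ _)).
  by rewrite -mulrDl ler_piMl ?sqr_ge0// stepD.
have E1 : A <= 4 * B.
  have i2 : lebesgue_measure.-integrable setT (fun u : R => (step u * kap (2 * u) * w u)%:E).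
    apply: (bounded_normal_pdf_integrable _ (M := 1)) => // [|u]; first exact: mstep.
    by apply: (step_bound (g := fun u => kap (2 * u))); exact: kap01.
  have le2 u : step u * kap (2 * u) * w (2 * u) <= step u * kap (2 * u) * w u.
    rewrite /step; case: ifPn => u0; last by rewrite !mul0r.
    by apply: ler_wpM2l (pdf_double u0); rewrite mul1r two_tail_ge0.
  have i22 : lebesgue_measure.-integrable setT
      (fun u : R => (step u * kap (2 * u) * w (2 * u))%:E).
    apply: le_integrable i2 => //.
      apply/measurable_EFinP; apply: measurable_funM; first exact: mstep.
      apply: (measurableT_comp (@measurable_normal_pdf R m sigma)).
      exact: measurable_funM.
    move=> u _; move: (u : R) => {}u; rewrite /= lee_fin !ger0_norm ?le2//;
      by rewrite mulr_ge0 ?normal_pdf_ge0// mulr_ge0 ?step_ge0 ?two_tail_ge0.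
  have mF : measurable_fun setT (fun u : R => step u * kap u * w u).
    apply: measurable_funM; last exact: measurable_normal_pdf.
    by apply: mstep; exact: measurable_two_tail.
  have F0 (u : R) : 0 <= step u * kap u * w u.
    by rewrite mulr_ge0 ?normal_pdf_ge0// mulr_ge0 ?step_ge0 ?two_tail_ge0.
  rewrite /A (Rintegral_scale (ltr0n R 2) mF F0).
  have step2 (u : R) : step (2 * u) = step u by rewrite /step pmulr_rgt0.
  under eq_Rintegral do rewrite step2.
  rewrite (_ : 4 * B = 2 * (2 * B)); last by ring.
  apply: (ler_wpM2l (ler0n R 2)).
  apply: (@le_trans _ _ (\int[lebesgue_measure]_u (step u * kap (2 * u) * w u))).
    exact: (lebesgue_int_le i22 i2).
  rewrite /B -(lebesgue_intZ iB).
  apply: (lebesgue_int_le i2 (integrable_scaleR 2 iB)) => u.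
  rewrite mulrA; apply: (ler_wpM2r (normal_pdf_ge0 _ _ _)).
  rewrite /step; case: ifPn => u0; last by rewrite !mul0r mulr0.
  rewrite !mul1r /kap normrM (gtr0_norm u0) ger0_norm//.
  exact/kappa_double/ltW.
rewrite E3 lerBlDl; apply: (le_trans E1).
by rewrite (_ : 4 * B = 2 * B + 2 * B) ?lerD2l//; ring.
Qed.

(** The ratio w(u) / w(-u) is exp(-x) with x = 2(-m)u / sigma^2, so w(-u) - w(u) <= x w(-u), which
    is linear in u. The factor u is absorbed by Mills' bound u k(u) <= phi(u), and phi has integral
    1. *)
Lemma orthant1_sub3 :
  orthant1 m sigma - orthant3 m sigma <= normal_peak sigma * (2 * - m / sigma ^+ 2).
Proof.
have hm := m0.
pose K := normal_peak sigma * (2 * - m / sigma ^+ 2).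
have K0 : 0 <= K.
  by rewrite mulr_ge0 ?normal_peak_ge0// divr_ge0 ?sqr_ge0// mulr_ge0// oppr_ge0.
have i3 : lebesgue_measure.-integrable setT (fun u : R => (step u * mid_tail u * w u)%:E).
  apply: (bounded_normal_pdf_integrable _ (M := 1)) => // [|u].
    by apply: mstep; exact: measurable_mid_tail.
  by apply: step_bound; exact: mid01.
have i1 : lebesgue_measure.-integrable setT (fun u : R => (step u * mid_tail u * w (- u))%:E).
  apply: (wN_integrable (M := 1)) => [|u].
    by apply: mstep; exact: measurable_mid_tail.
  by apply: step_bound; exact: mid01.
have iphi : lebesgue_measure.-integrable setT (fun u : R => (phi u : R)%:E).
  exact: integrable_normal_pdf.
have iK : lebesgue_measure.-integrable setT (fun u : R => (K * phi u)%:E).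
  exact: (integrable_scaleR K iphi).
rewrite -/K orthant1E /orthant3 -(lebesgue_intB i1 i3).
rewrite -[leRHS]mulr1 -(Rintegral_normal_pdf (0 : R) 1) -(lebesgue_intZ iphi).
apply: (lebesgue_int_le (integrable_subR i1 i3) iK) => u.
rewrite /step; case: ifPn => u0; last first.
  by rewrite !mul0r subrr mulr_ge0 ?normal_pdf_ge0.
rewrite !mul1r -mulrBr.
have Hw : w (- u) - w u <= K * u.
  have E : w u = w (- u) * expR (- (2 * - m / sigma ^+ 2 * u)).
    rewrite !wE -[RHS]mulrA -expRD; congr (_ * expR _); field.
    exact: sn0.
  set x := 2 * - m / sigma ^+ 2 * u in E.
  have x0 : 0 <= x.
    by rewrite !mulr_ge0 ?oppr_ge0 ?invr_ge0 ?sqr_ge0// ltW.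
  have ub : w (- u) <= normal_peak sigma by apply: normal_pdf_ub; exact: sn0.
  have w0 : 0 <= w (- u) by exact: normal_pdf_ge0.
  have e1 : 1 - expR (- x) <= x by have := expR_ge1Dx (- x); lra.
  rewrite E -[X in X - _]mulr1 -mulrBr.
  apply: (le_trans (ler_wpM2l w0 e1)).
  by rewrite /K -mulrA; exact: ler_wpM2r.
apply: (le_trans (ler_wpM2l (mid_tail_ge0 u) Hw)).
rewrite mulrCA ler_wpM2l// mulrC (le_trans (ler_wpM2l (ltW u0) (mid_tail_le u)))//.
by rewrite /kap (gtr0_norm u0); apply: mills_ratio; exact: ltW.
Qed.

(** Restrict to [1/2, 1], an interval of length 1/2, and bound each factor by its value at the less
    favourable endpoint. *)
Lemma orthant3_ge :
  2^-1 * ((1 - 2 * normal_tail 2^-1) * normal_tail 1 * w 1) <= orthant3 m sigma.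
Proof.
have hm := m0.
set L := _ * w 1.
have L0 : 0 <= L.
  rewrite mulr_ge0 ?normal_pdf_ge0// mulr_ge0 ?kappa_ge0//.
  have := @kappa_le R 0 2^-1; rewrite kappa0 => H; have : 0 <= 2^-1 :> R by lra.
  by move=> /H; lra.
have iI : lebesgue_measure.-integrable setT (fun u : R => (\1_(`[2^-1, 1]) u : R)%:E).
  exact: integrable_indic_itv.
have iL : lebesgue_measure.-integrable setT (fun u : R => (L * \1_(`[2^-1, 1]) u : R)%:E).
  exact: (integrable_scaleR L iI).
have -> : 2^-1 * L = \int[lebesgue_measure]_u (L * \1_(`[2^-1, 1]) u).
  rewrite (lebesgue_intZ iI) mulrC; congr (_ * _).
  rewrite /Rintegral integral_indic//= setIT lebesgue_measure_itv/= lte_fin.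
  by rewrite ifT/=; lra.
have i3 : lebesgue_measure.-integrable setT (fun u : R => (step u * mid_tail u * w u)%:E).
  apply: (bounded_normal_pdf_integrable _ (M := 1)) => // [|u].
    by apply: mstep; exact: measurable_mid_tail.
  by apply: step_bound; exact: mid01.
apply: (lebesgue_int_le iL i3) => u.
rewrite indicE; case: (boolP (u \in `[2^-1, 1]%classic)); last first.
  move=> _; rewrite mulr0 mulr_ge0 ?normal_pdf_ge0// mulr_ge0 ?step_ge0//.
  exact: mid_tail_ge0.
rewrite inE/= in_itv/= => /andP[u1 u2]; have u0 : 0 < u by lra.
rewrite mulr1 /step u0 mul1r /mid_tail /kap (gtr0_norm u0) /L.
have k1 : normal_tail u <= normal_tail 2^-1 := kappa_le u1.
have k2 : normal_tail 1 <= normal_tail u := kappa_le u2.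
have k3 : normal_tail 2^-1 <= 2^-1 :> R.
  by rewrite -[leRHS]kappa0; apply: kappa_le; lra.
have k4 := kappa_ge0 (1 : R).
apply: ler_pM; rewrite ?normal_pdf_ge0//.
- by rewrite mulr_ge0//; lra.
- by apply: ler_pM => //; lra.
- by apply: normal_pdf_le; rewrite !ger0_norm; lra.
Qed.

(** Bound w by its peak. The integral of k^2 is at most 2, because k^2 <= 1/2 on [-1, 1] and, by
    Mills' bound, k^2 <= phi outside. *)
Lemma orthant2_le : orthant2 m sigma <= 2 * normal_peak sigma.
Proof.
set K := normal_peak sigma.
have K0 : 0 <= K by exact: normal_peak_ge0.
have iI : lebesgue_measure.-integrable setT (fun u : R => (\1_(`[(-1), 1]) u : R)%:E).
  exact: integrable_indic_itv.
have iphi : lebesgue_measure.-integrable setT (fun u : R => (phi u : R)%:E).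
  exact: integrable_normal_pdf.
have i1 : lebesgue_measure.-integrable setT
    (fun u : R => (2^-1 * \1_(`[(-1), 1]) u : R)%:E).
  exact: (integrable_scaleR 2^-1 iI).
have i2 : lebesgue_measure.-integrable setT
    (fun u : R => (2^-1 * \1_(`[(-1), 1]) u + phi u : R)%:E).
  exact: (integrable_addR i1 iphi).
have i3 : lebesgue_measure.-integrable setT
    (fun u : R => (K * (2^-1 * \1_(`[(-1), 1]) u + phi u) : R)%:E).
  exact: (integrable_scaleR K i2).
have -> : 2 * K = \int[lebesgue_measure]_u (K * (2^-1 * \1_(`[(-1), 1]) u + phi u)).
  rewrite (lebesgue_intZ i2) (lebesgue_intD i1 iphi) (lebesgue_intZ iI) Rintegral_normal_pdf.
  rewrite /Rintegral integral_indic//= setIT lebesgue_measure_itv/= lte_fin.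
  by rewrite ifT/=; lra.
have ik : lebesgue_measure.-integrable setT (fun u : R => (kap u ^+ 2 * w u)%:E).
  apply: (bounded_normal_pdf_integrable _ (M := 1)) => // [|u].
    by apply: measurable_funX; exact: measurable_two_tail.
  by have /andP[k1 k2] := kap01 u; rewrite ger0_norm ?sqr_ge0// exprn_ile1.
apply: (lebesgue_int_le ik i3) => u.
rewrite mulrC; apply: ler_pM; rewrite ?normal_pdf_ge0 ?sqr_ge0//.
  exact: normal_pdf_ub.
have k0 := two_tail_ge0 u; have k1 := two_tail_le u.
have p0 : 0 <= phi u := normal_pdf_ge0 0 1 u.
rewrite indicE; case: (boolP (u \in `[(-1), 1]%classic)) => /=; first by nra.
rewrite notin_setE/= in_itv/= => /negP; rewrite -ler_norml -ltNge => u1.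
have := mills_ratio (normr_ge0 u); rewrite -/(kap u).
have -> : phi `|u| = phi u by rewrite !phiE real_normK ?num_real.
by nra.
Qed.

End orthants.

Lemma integral_two_tail_phi (R : realType) :
  \int[lebesgue_measure]_u (two_tail u * normal_pdf 0 1 u) = 4^-1 :> R.
Proof.
have c : continuous (fun u : R => two_tail u * normal_pdf 0 1 u).
  move=> u; apply: cvgM.
    apply: (@continuous_comp _ _ _ (fun u : R => `|u|) (@normal_tail R)).
      exact: norm_continuous.
    exact: kappa_continuous.
  by apply: continuous_normal_pdf; exact: oner_neq0.
rewrite /Rintegral ge0_symfun_integralT//.
- rewrite (_ : [set x | 0 <= x] = `[0, +oo[%classic); last first.
    by apply/seteqP; split=> u /=; rewrite in_itv/= andbT.
  under eq_integral.
    move=> u; rewrite inE/= in_itv/= andbT => u0.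
    by rewrite /two_tail (ger0_norm u0); over.
  by rewrite integral_kappa_phi -EFinM/=; field.
- by move=> u; rewrite mulr_ge0 ?two_tail_ge0 ?normal_pdf_ge0.
- by move=> u /=; rewrite two_tailN phiN.
Qed.

Lemma normal_peak_scale (R : realType) (sigma : R) : 0 < sigma ->
  normal_peak sigma = sigma^-1 * normal_peak 1.
Proof.
move=> s0; rewrite /normal_peak expr1n mul1r -mulrnAr sqrtrM ?sqr_ge0// sqrtr_sqr.
by rewrite (gtr0_norm s0) invfM.
Qed.

Lemma normal_pdf_scale (R : realType) (sigma u : R) : 0 < sigma ->
  sigma * normal_pdf 0 sigma (sigma * u) = normal_pdf 0 1 u.
Proof.
move=> s0; have sn0 : sigma != 0 by rewrite gt_eqF.
rewrite phiE (normal_pdfE _ sn0) (normal_peak_scale s0) mulrA mulVKf//; congr (_ * expR _).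
by rewrite subr0; field.
Qed.

(** Substituting sigma u makes the density standard and k(sigma u) <= k(u). The bound is attained at
    sigma = 1, that is, theta = pi/4. *)
Lemma integral_two_tail_normal_le (R : realType) (sigma : R) : 1 <= sigma ->
  \int[lebesgue_measure]_u (two_tail u * normal_pdf 0 sigma u) <= 4^-1.
Proof.
move=> s1; have s0 : 0 < sigma by lra.
have sn0 : sigma != 0 by rewrite gt_eqF.
pose w := normal_pdf 0 sigma.
have mk := @measurable_two_tail R.
have mw : measurable_fun setT w by exact: measurable_normal_pdf.
have k0 := @two_tail_ge0 R; have k1 := @two_tail_le R.
have mF : measurable_fun setT (fun u : R => two_tail u * w u) by exact: measurable_funM.
have F0 (u : R) : 0 <= two_tail u * w u by rewrite mulr_ge0 ?normal_pdf_ge0.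
rewrite (Rintegral_scale s0 mF F0).
have wE (u : R) : sigma * w (sigma * u) = normal_pdf 0 1 u := normal_pdf_scale u s0.
have mks : measurable_fun setT (fun u : R => two_tail (sigma * u)).
  by apply: (measurableT_comp mk); exact: measurable_funM.
have iks : lebesgue_measure.-integrable setT
    (fun u : R => (two_tail (sigma * u) * normal_pdf 0 1 u)%:E).
  apply: (@bounded_normal_pdf_integrable R 0 1 2 _ (oner_neq0 R) mks) => u.
  by rewrite (ger0_norm (k0 _)); have := k1 (sigma * u); lra.
have ik1 : lebesgue_measure.-integrable setT
    (fun u : R => (two_tail u * normal_pdf 0 1 u : R)%:E).
  apply: (@bounded_normal_pdf_integrable R 0 1 2 _ (oner_neq0 R) mk) => u.
  by rewrite (ger0_norm (k0 _)); have := k1 u; lra.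
have iw : lebesgue_measure.-integrable setT
    (fun u : R => (two_tail (sigma * u) * w (sigma * u))%:E).
  rewrite (_ : (fun u : R => _) = (fun u : R =>
      (sigma^-1 * (two_tail (sigma * u) * normal_pdf 0 1 u))%:E)); last first.
    by apply/funext => u; rewrite -wE mulrCA mulKf.
  exact: (integrable_scaleR sigma^-1 iks).
rewrite -(integral_two_tail_phi R) -(lebesgue_intZ iw).
apply: (lebesgue_int_le (integrable_scaleR sigma iw) ik1) => u.
rewrite mulrCA wE; apply: (ler_wpM2r (normal_pdf_ge0 _ _ _)).
by apply: kappa_le; rewrite normrM (gtr0_norm s0) ler_peMl.
Qed.

(** The density is even, so the integrand H may be symmetrized: H(u) + H(-u) <= 2k^2 + (1 - 2k)k =
    k, whose integral is at most 1/4. *)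
Lemma orthant_sum_le (R : realType) (sigma : R) : 1 <= sigma ->
  orthant2 0 sigma + orthant3 0 sigma <= 8^-1.
Proof.
move=> s1; have s0 : 0 < sigma by lra.
have sn0 : sigma != 0 by rewrite gt_eqF.
pose w := normal_pdf 0 sigma.
have wN u : w (- u) = w u by rewrite /w !normal_pdfE// /normal_fun !subr0 sqrrN.
have mk := @measurable_two_tail R; have mm := @measurable_mid_tail R.
have ms := @measurable_step R.
have mw : measurable_fun setT w by exact: measurable_normal_pdf.
have k0 := @two_tail_ge0 R; have k1 := @two_tail_le R.
have t0 := @mid_tail_ge0 R; have t1 := @mid_tail_le R.
have p0 := @step_ge0 R; have p1 := @step_le1 R.
have k2 u : two_tail u ^+ 2 <= 1 :> R by have := k0 u; have := k1 u; nra.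
have sm u : step u * mid_tail u <= 1 :> R.
  by rewrite mulr_ile1//; have := k1 u; have := t1 u; lra.
pose H (u : R) := two_tail u ^+ 2 + step u * mid_tail u.
have mH : measurable_fun setT H.
  by apply: measurable_funD; [exact: measurable_funX|exact: measurable_funM].
have H0 u : 0 <= H u by rewrite addr_ge0 ?sqr_ge0// mulr_ge0.
have e48 : 4^-1 <= 2 * 8^-1 :> R by lra.
have HH (u : R) : H u + H (- u) <= two_tail u.
  rewrite /H two_tailN mid_tailN.
  have sN : step u + step (- u) <= 1.
    by rewrite /step oppr_gt0; case: (ltrgtP u 0); rewrite ?addr0 ?add0r.
  have : (step u + step (- u)) * mid_tail u <= mid_tail u by rewrite ler_piMl.
  by rewrite [X in _ <= X]/mid_tail mulrDl; lra.
have HM u : `|H u| <= 2.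
  by rewrite ger0_norm// /H; have := k2 u; have := sm u; lra.
have iH : lebesgue_measure.-integrable setT (fun u : R => (H u * w u)%:E).
  exact: (bounded_normal_pdf_integrable _ (M := 2)).
have iHN : lebesgue_measure.-integrable setT (fun u : R => (H (- u) * w u)%:E).
  by apply: (bounded_normal_pdf_integrable _ (M := 2)) => //; apply: measurableT_comp.
have ik : lebesgue_measure.-integrable setT (fun u : R => (two_tail u * w u)%:E).
  apply: (bounded_normal_pdf_integrable _ (M := 2)) => // u.
  by rewrite ger0_norm//; have := k1 u; lra.
have i2 : lebesgue_measure.-integrable setT (fun u : R => (two_tail u ^+ 2 * w u)%:E).
  apply: (bounded_normal_pdf_integrable _ (M := 2)) => // [|u].
    exact: measurable_funX.
  by rewrite ger0_norm ?sqr_ge0//; have := k2 u; lra.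
have i3 : lebesgue_measure.-integrable setT
    (fun u : R => (step u * mid_tail u * w u)%:E).
  apply: (bounded_normal_pdf_integrable _ (M := 2)) => // [|u].
    exact: measurable_funM.
  by rewrite (ger0_norm (mulr_ge0 (p0 u) (t0 u))); have := sm u; lra.
have E : orthant2 0 sigma + orthant3 0 sigma = \int[lebesgue_measure]_u (H u * w u).
  rewrite /orthant2 /orthant3 -(lebesgue_intD i2 i3).
  by apply: eq_Rintegral => u _; rewrite -mulrDl.
have EN : \int[lebesgue_measure]_u (H u * w u) = \int[lebesgue_measure]_u (H (- u) * w u).
  rewrite -Rintegral_opp.
  - by apply: eq_Rintegral => u _; rewrite wN.
  - exact: measurable_funM.
  - by move=> u; rewrite mulr_ge0 ?normal_pdf_ge0.
have E2 : 2 * \int[lebesgue_measure]_u (H u * w u) <=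
    \int[lebesgue_measure]_u (two_tail u * w u).
  rewrite (_ : 2 * _ = \int[lebesgue_measure]_u (H u * w u) +
    \int[lebesgue_measure]_u (H (- u) * w u)); last by rewrite -EN; ring.
  rewrite -(lebesgue_intD iH iHN).
  apply: (lebesgue_int_le (integrable_addR iH iHN) ik) => u.
  by rewrite -mulrDl; apply: (ler_wpM2r (normal_pdf_ge0 _ _ _)); exact: HH.
have E3 := integral_two_tail_normal_le s1.
rewrite E -(ler_pM2l (ltr0n R 2)).
exact: (le_trans E2 (le_trans E3 e48)).
Qed.

(** * Pattern probabilities *)

Lemma big_pat (V : zmodType) (F : {ffun 'I_4 -> bool} -> V) :
  \sum_y F y = \sum_b0 \sum_b1 \sum_b2 \sum_b3 F (pat b0 b1 b2 b3).
Proof.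
rewrite !pair_big/=.
rewrite (reindex (fun b : bool * bool * bool * bool =>
  pat b.1.1.1 b.1.1.2 b.1.2 b.2))//=.
exists (fun y : {ffun 'I_4 -> bool} => (y o0, y o1, y o2, y o3)) => [[[[b0 b1] b2] b3] _|y _].
  by rewrite !ffunE.
by rewrite [RHS]patE.
Qed.

Section pattern_prob.
Context (R : realType) (d : measure_display) (T : measurableType d)
  (P : probability T R) (X : 'I_4 -> {RV P >-> R}) (h : R).

Definition pattern_prob (y : {ffun 'I_4 -> bool}) : R :=
  fine (P [set w | forall i, threshold X h i w = y i]).

Lemma measurable_threshold_pattern (y : {ffun 'I_4 -> bool}) :
  measurable [set w | forall i, threshold X h i w = y i].
Proof.
have -> : [set w | forall i, threshold X h i w = y i] =
    \bigcap_(i in [set: 'I_4]) [set w | threshold X h i w = y i].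
  by apply/seteqP; split=> w /= H i; [move=> _; exact: H|exact: (H i)].
apply: fin_bigcap_measurable => [|i _]; first exact: finite_finset.
rewrite (_ : [set w | _] = X i @^-1` [set` if y i then `]h, +oo[ else `]-oo, h]]).
  by rewrite -[X in measurable X]setTI; apply: measurable_funPT => //; exact: measurable_itv.
apply/seteqP; split=> w; rewrite /threshold/=; case: (y i); rewrite in_itv/= ?andbT//.
- by move=> /negbT; rewrite -leNgt.
- by rewrite leNgt => /negbTE.
Qed.

Lemma pattern_probE (y : {ffun 'I_4 -> bool}) :
  P [set w | forall i, threshold X h i w = y i] = (pattern_prob y)%:E.
Proof. by rewrite fineK// fin_num_measure//; exact: measurable_threshold_pattern. Qed.

Lemma pattern_prob_ge0 y : 0 <= pattern_prob y.
Proof. by rewrite -lee_fin -pattern_probE. Qed.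

Lemma pattern_prob_sum (Phi : pred {ffun 'I_4 -> bool}) :
  P [set w | Phi [ffun i => threshold X h i w]] = (\sum_(y | Phi y) pattern_prob y)%:E.
Proof.
have -> : [set w | Phi [ffun i => threshold X h i w]] =
    \bigcup_(y in [set` Phi]) [set w | forall i, threshold X h i w = y i].
  apply/seteqP; split=> [w Hw|w [y /= Hy Hw]]/=.
    by exists [ffun i => threshold X h i w] => // i; rewrite ffunE.
  by rewrite (_ : [ffun i => _] = y)//; apply/ffunP => i; rewrite ffunE Hw.
rewrite measure_fin_bigcup//.
- rewrite -(bigfs _ (index_enum_uniq _))//; last by move=> i _; rewrite mem_index_enum.
  by rewrite -sumEFin; apply: eq_bigr => y _; exact: pattern_probE.
- move=> y z _ _ [w [/= Hy Hz]]; apply/ffunP => i; by rewrite -Hy -Hz.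
- by move=> y _; exact: measurable_threshold_pattern.
Qed.

End pattern_prob.

(** The three squares are the variances of the independent U, V1, V2 parts of a linear combination
    of the model coordinates; they match the exponent in [tetra_cos]. *)
Lemma covA_quadratic (R : realType) (theta : R) (a : 'I_4 -> R) :
  \sum_i \sum_j a i * a j * covA theta i j =
  (cos theta * \sum_i a i) ^+ 2 + (sin theta * (a o0 - a o2)) ^+ 2
    + (sin theta * (a o1 - a o3)) ^+ 2.
Proof.
rewrite !big_ord4 !mxE/=.
have s2 : sin theta ^+ 2 = 1 - cos theta ^+ 2 by rewrite sin2cos2.
rewrite !exprMn s2; ring.
Qed.

Section tetrahedron.
Context (R : realType) (d : measure_display) (T : measurableType d)
  (P : probability T R) (X : 'I_4 -> {RV P >-> R}) (theta : R).
Hypothesis gX : centered_gaussian_vector X (covA theta).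

Lemma marginal_tail (h : R) (i : 'I_4) : P [set w | h < X i w] = (kappa h)%:E.
Proof.
pose a j : R := (j == i)%:R.
have sum1 (F : 'I_4 -> R) : \sum_j a j * F j = F i.
  by rewrite (bigD1 i)//= /a eqxx mul1r big1 ?addr0// => j /negbTE->; rewrite mul0r.
have [t [t0 t2 law _]] := gaussian_vector_law a gX.
have t1 : t = 1.
  apply/eqP; rewrite -(@eqrXn2 _ 2)// expr1n t2.
  under eq_bigr do under eq_bigr do rewrite -mulrA.
  under eq_bigr do rewrite -mulr_sumr.
  by rewrite !sum1 mxE eqxx.
rewrite -normal_prob_ccdfo.
have := law `]h, +oo[%classic (measurable_itv _).
rewrite /gaussian_law t1 oner_eq0 => <-; congr (P _).
by apply/seteqP; split=> w /=; rewrite sum1 in_itv/= andbT.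
Qed.

Hypotheses (s0 : 0 < sin theta) (c0 : 0 < cos theta).
Context (h : R).
Local Notation nu := (pattern_prob X h).
Local Notation m := (- h / sin theta).
Local Notation sigma := (cos theta / sin theta).

Let sigma0 : 0 < sigma. Proof. exact: divr_gt0. Qed.

(** The choice m = - h / sin theta gives the model coordinates mean 0 and at the same time turns the
    level h into level 0 for U + V and U - V. *)
Lemma pattern_prob_tetra (y : {ffun 'I_4 -> bool}) :
  nu y = fine (tetra_prob m sigma
    [set z | forall i, (h < tetra_coord h (sin theta) i z) = y i]).
Proof.
rewrite /pattern_prob /threshold; congr fine.
apply: (threshold_same_law (Y := tetra_coord h (sin theta))) => [i|i|a b].
- by [].
- exact: measurable_tetra_coord.
have [t [_ _ _ ->]] := gaussian_vector_law a gX.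
rewrite tetra_cos ?gt_eqF// covA_quadratic.
have sn0 : sin theta != 0 by rewrite gt_eqF.
have h0 : h + sin theta * m = 0 by rewrite mulrC divfK// subrr.
by rewrite mulrA divfK// h0 -mulr_suml mulr0 add0r.
Qed.

Lemma pattern_prob_rotation : rotation_invariant nu.
Proof.
move=> b0 b1 b2 b3; rewrite (pattern_prob_tetra (pat b0 b1 b2 b3)).
rewrite (pattern_prob_tetra (pat b3 b0 b1 b2)); apply: (congr1 fine).
exact: (tetra_rotation h m sigma b0 b1 b2 b3 s0).
Qed.

Lemma pattern_prob_integral (y0 y1 y2 y3 : bool) (f : R -> R) :
  measurable_fun setT f -> (forall u, 0 <= f u) ->
  (forall u, normal_prob 0 1 (slab u y0 y2) * normal_prob 0 1 (slab u y1 y3)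
    = (f u)%:E)%E ->
  nu (pat y0 y1 y2 y3) = \int[lebesgue_measure]_u (f u * normal_pdf m sigma u).
Proof.
move=> mf f0 Hf; rewrite pattern_prob_tetra.
by apply: tetra_pattern => //; rewrite gt_eqF.
Qed.

(** One opposite pair would be positive and the other nonpositive, which needs u > 0 and u <= 0
    together. *)
Lemma pattern_prob_1010 : nu (pat true false true false) = 0.
Proof.
rewrite (pattern_prob_integral (f := cst 0))//.
  rewrite /Rintegral integral0_eq// => u _.
  by rewrite mul0r.
by move=> u; rewrite !slab_prob; case: ifPn; rewrite ?mul0e ?mule0.
Qed.

Lemma pattern_prob_1110 : nu (pat true true true false) = orthant3 m sigma.
Proof.
rewrite (pattern_prob_integral (f := fun u => step u * mid_tail u))//.
- by apply: measurable_funM; [exact: measurable_step|exact: measurable_mid_tail].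
- by move=> u; rewrite mulr_ge0 ?step_ge0 ?mid_tail_ge0.
- move=> u; rewrite !slab_prob -EFinM /step /mid_tail /two_tail; case: ifPn => _.
    by rewrite mul1r.
  by rewrite !mul0r.
Qed.

Lemma pattern_prob_1000 : nu (pat true false false false) = orthant1 m sigma.
Proof.
rewrite (pattern_prob_integral (f := fun u => (1 - step u) * mid_tail u))//.
- apply: measurable_funM; last exact: measurable_mid_tail.
  by apply: measurable_funB => //; exact: measurable_step.
- by move=> u; rewrite mulr_ge0 ?subr_ge0 ?step_le1 ?mid_tail_ge0.
- move=> u; rewrite !slab_prob -EFinM /step /mid_tail /two_tail; case: ifPn => _.
    by rewrite subrr mul0r mulr0.
  by rewrite subr0 mul1r mulrC.
Qed.

Lemma pattern_prob_1100 : nu (pat true true false false) = orthant2 m sigma.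
Proof.
rewrite (pattern_prob_integral (f := fun u => two_tail u ^+ 2))//.
- by apply: measurable_funX; exact: measurable_two_tail.
- by move=> u; exact: sqr_ge0.
- by move=> u; rewrite !slab_prob -EFinM.
Qed.

End tetrahedron.

Section tetrahedron_color.
Context (R : realType) (d : measure_display) (T : measurableType d)
  (P : probability T R) (X : 'I_4 -> {RV P >-> R}) (theta : R).
Hypotheses (gX : centered_gaussian_vector X (covA theta))
  (s0 : 0 < sin theta) (c0 : 0 < cos theta).
Context (h : R).
Local Notation nu := (pattern_prob X h).
Local Notation m := (- h / sin theta).
Local Notation sigma := (cos theta / sin theta).
Let n0 := nu (pat false false false false).
Let n1 := nu (pat true false false false).
Let n2 := nu (pat true true false false).
Let n3 := nu (pat true true true false).
Let n4 := nu (pat true true true true).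

Let nuM := rotation_invariantE (@pattern_prob_rotation _ _ _ _ _ _ gX s0 c0 h)
  (pattern_prob_1010 gX s0 c0 h).

(** Only the eleven patterns that are not orbit representatives: the equations for the other five
    are trivial and would make rewriting loop. *)
Let nuE := (nuM false false false true, nuM false false true false,
  nuM false false true true, nuM false true false false, nuM false true false true,
  nuM false true true false, nuM false true true true, nuM true false false true,
  nuM true false true false, nuM true false true true, nuM true true false true).

Lemma pattern_prob_total : n0 + 4 * n1 + 4 * n2 + 4 * n3 + n4 = 1.
Proof.
apply: EFin_inj; have := pattern_prob_sum X h predT; rewrite (_ : [set w | _] = setT).
  rewrite probability_setT => ->; congr EFin.
  rewrite big_pat !big_bool.
rewrite /= !nuE /= /n0 /n1 /n2 /n3 /n4.
ring.
by apply/seteqP; split.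
Qed.

Lemma pattern_prob_marginal : n4 + 3 * n3 + 2 * n2 + n1 = kappa h.
Proof.
apply: EFin_inj; rewrite -(marginal_tail gX h o0).
have := pattern_prob_sum X h (fun y => y o0).
rewrite big_mkcond big_pat !big_bool /= !ffunE /= !nuE /=.
rewrite (_ : [set w | _] = [set w | h < X o0 w]); last first.
  by apply/seteqP; split=> w /=; rewrite ffunE.
by move=> ->; rewrite /n0 /n1 /n2 /n3 /n4; congr EFin; ring.
Qed.

Lemma pattern_prob_adjacent :
  P [set w | h < X o0 w /\ h < X o1 w] = (n4 + 2 * n3 + n2)%:E.
Proof.
have := pattern_prob_sum X h (fun y => y o0 && y o1).
rewrite big_mkcond big_pat !big_bool /= !ffunE /= !nuE /=.
rewrite (_ : [set w | _] = [set w | h < X o0 w /\ h < X o1 w]); last first.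
  by apply/seteqP; split=> w /=; rewrite !ffunE => /andP.
by move=> ->; rewrite /n0 /n1 /n2 /n3 /n4; congr EFin; ring.
Qed.

Lemma weighted_ones_pattern_prob : weighted_ones nu = 4 * kappa h.
Proof.
rewrite -pattern_prob_marginal /weighted_ones !nuE /= /n1 /n2 /n3 /n4; ring.
Qed.

Lemma odd_imbalance_pattern_prob : odd_imbalance nu = 4 * (n1 - n3).
Proof. by rewrite /odd_imbalance !nuE /= /n1 /n3; ring. Qed.

Lemma tetrahedron_color_process (p := kappa h) (b c e : R) :
  0 <= b -> 0 <= c -> 0 <= e -> 2 * b + 4 * c + 4 * e <= 1 ->
  orthant3 m sigma = p * (1 - p) * (c + 2 * e * p) ->
  orthant1 m sigma = p * (1 - p) * (c + 2 * e * (1 - p)) ->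
  orthant2 m sigma = p * (1 - p) * (b + e) ->
  color_process P (threshold X h).
Proof.
move=> b0 c0' e0 bce h3 h1 h2; exists p.
have [q [rq Hq]] : exists q, random_partition q /\ forall y, color_pmf p q y = nu y.
  apply: (@cyclic_color_process _ nu p (1 - 2 * b - 4 * c - 4 * e) b c e) => //.
  - exact: pattern_prob_rotation gX s0 c0 h.
  - exact: pattern_prob_marginal.
  - exact: pattern_prob_total.
  - lra.
  - lra.
  - by rewrite (pattern_prob_1110 gX s0 c0 h).
  - by rewrite (pattern_prob_1000 gX s0 c0 h).
  - by rewrite (pattern_prob_1100 gX s0 c0 h).
exists q; split=> //; first by rewrite kappa_ge0 kappa_le1.
by move=> y; rewrite Hq; exact: pattern_probE.
Qed.

End tetrahedron_color.

(** * Existence of color representations *)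

Lemma normal_peak1_le1 (R : realType) : normal_peak 1 <= 1 :> R.
Proof.
have p2 : 1 <= pi *+ 2 :> R by have := pi_ge2 R; rewrite mulr2n; lra.
rewrite /normal_peak expr1n mul1r invf_le1 ?sqrtr_gt0; last exact: lt_le_trans p2.
by rewrite -{1}(sqrtr1 R) ler_wsqrtr.
Qed.

Lemma kappa_gt0 (R : realType) (u : R) : 0 <= u -> 0 < kappa u.
Proof.
move=> u0; have u1 : u <= u + 1 by rewrite lerDl.
have := kappa_diff u0 u1; rewrite addrAC subrr add0r mul1r => /andP[+ _].
by have := phi_gt0 (u + 1); have := kappa_ge0 (u + 1); lra.
Qed.

Lemma kappa_lt_half (R : realType) (u : R) : 0 < u -> kappa u < 2^-1.
Proof.
move=> u0; have := kappa_diff (lexx 0) (ltW u0); rewrite subr0 kappa0 => /andP[+ _].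
by have := mulr_gt0 u0 (phi_gt0 u); lra.
Qed.

Lemma sin_le_id (R : realType) (x : R) : 0 <= x -> sin x <= x.
Proof.
move=> x0; have df (y : R) : is_derive y (1 : R) (fun y => sin y - y) (cos y - 1).
  exact: is_deriveB.
have := derive_le0_le x0 df; rewrite sin0 subr0 subr_le0; apply => y _.
by rewrite subr_le0 cos_le1.
Qed.

Lemma first_octant (R : realType) (theta : R) : 0 < theta <= pi / 4 ->
  [/\ 0 < sin theta, 0 < cos theta & sin theta <= cos theta].
Proof.
have p0 := pi_gt0 R; move=> /andP[t0 t1].
have s0 : 0 < sin theta by apply: sin_gt0_pihalf; apply/andP; split; lra.
have c0 : 0 < cos theta by apply: cos_gt0_pihalf; apply/andP; split; lra.
split => //; have : 0 <= cos (theta *+ 2).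
  by apply: cos_ge0_pihalf; rewrite -(mulr_natl theta); apply/andP; split; lra.
rewrite cos_mulr2n -(mulr_natl (cos theta ^+ 2)).
rewrite -(@ler_pXn2r _ 2 isT (sin theta)) ?nnegrE ?(ltW s0) ?(ltW c0)//.
by have := cos2Dsin2 theta; lra.
Qed.

Section color.
Context (R : realType) (d : measure_display) (T : measurableType d)
  (P : probability T R) (X : 'I_4 -> {RV P >-> R}) (theta : R).
Hypotheses (gX : centered_gaussian_vector X (covA theta))
  (s0 : 0 < sin theta) (c0 : 0 < cos theta).

Lemma color_process_median : sin theta <= cos theta ->
  color_process P (threshold X 0).
Proof.
move=> sc; have sigma1 : 1 <= cos theta / sin theta by rewrite ler_pdivlMr// mul1r.
have sigma0 : 0 < cos theta / sin theta by lra.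
have m0 : - 0 / sin theta = 0 by rewrite oppr0 mul0r.
pose n3 := orthant3 0 (cos theta / sin theta).
pose n2 := orthant2 0 (cos theta / sin theta).
have E1 : orthant1 0 (cos theta / sin theta) = n3.
  have wN u : normal_pdf 0 (cos theta / sin theta) (- u) =
      normal_pdf 0 (cos theta / sin theta) u.
    by rewrite !normal_pdfE ?gt_eqF// /normal_fun !subr0 sqrrN.
  rewrite orthant1E.
  by apply: eq_Rintegral => u _; rewrite wN.
have n30 : 0 <= n3.
  apply: (le_trans _ (orthant3_ge (lexx 0) sigma0)).
  have k2 : kappa 2^-1 < 2^-1 :> R by apply: kappa_lt_half; rewrite invr_gt0.
  have k1 : 0 <= 1 - 2 * kappa 2^-1 :> R by lra.
  by rewrite !mulr_ge0 ?normal_pdf_ge0 ?kappa_ge0.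
have n32 : n3 <= n2 by exact: orthant3_le2.
have n23 : n2 + n3 <= 8^-1 by exact: orthant_sum_le.
(* At p = 1/2 only c + e = 4 n3 and b + e = 4 n2 are prescribed. Taking c = 0 makes e as large as
   possible, which minimizes 2b + 4c + 4e, here equal to 8(n2 + n3), and leaves b = 4(n2 - n3). *)
apply: (@tetrahedron_color_process _ _ _ _ _ _ gX s0 c0 0 (4 * (n2 - n3)) 0 (4 * n3));
  rewrite ?m0 ?kappa0 ?E1 -/n3 -/n2; lra.
Qed.

End color.

(** Subtracting the first two equations gives e = x / (2q), where q = p(1-p) and x = (n1 - n3) / (1
    - 2p); then c and b follow. The bound on n1 - n3 says x <= n3, which makes b and c nonnegative.
    Finally q >= 1/8 and n2 <= 1/64 give n2 / q <= 1/8, and the weights total at most 7/8. *)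
Lemma color_weights_exist (R : realType) (p n1 n2 n3 : R) :
  4^-1 <= p -> p < 2^-1 -> 0 <= n3 -> n3 <= n1 -> n1 - n3 <= (1 - 2 * p) * n3 ->
  n3 <= n2 -> n2 <= 64^-1 -> exists b c e : R,
  [/\ [/\ 0 <= b, 0 <= c, 0 <= e & 2 * b + 4 * c + 4 * e <= 1],
      n3 = p * (1 - p) * (c + 2 * e * p),
      n1 = p * (1 - p) * (c + 2 * e * (1 - p)) &
      n2 = p * (1 - p) * (b + e)].
Proof.
move=> p4 p2 n30 n31 D n32 n2s.
have rp : 0 < 1 - 2 * p by lra.
have pr : 8^-1 <= p * (1 - p) by nra.
pose q := p * (1 - p); have q0 : 0 < q by rewrite /q; lra.
pose x := (n1 - n3) / (1 - 2 * p).
have x0 : 0 <= x by rewrite divr_ge0 ?(ltW rp) ?subr_ge0.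
have xn : x <= n3 by rewrite ler_pdivrMr// mulrC.
have xE : n1 - n3 = x * (1 - 2 * p) by rewrite divfK// gt_eqF.
exists ((n2 - x / 2) / q), ((n3 - x * p) / q), (x / (2 * q)).
have qn : q != 0 by rewrite gt_eqF.
have n2q : n2 / q <= 8^-1 by rewrite ler_pdivrMr//; rewrite /q; lra.
have n3q : n3 / q <= n2 / q by rewrite ler_pM2r ?invr_gt0.
have xq : x / q <= n3 / q by rewrite ler_pM2r ?invr_gt0.
have xq0 : 0 <= x / q by rewrite divr_ge0// ltW.
have xp : 0 <= x / q * p by rewrite mulr_ge0//; lra.
split; first split.
- by rewrite divr_ge0 ?(ltW q0)//; lra.
- by rewrite divr_ge0 ?(ltW q0)//; nra.
- by rewrite divr_ge0//; lra.
- have -> : 2 * ((n2 - x / 2) / q) + 4 * ((n3 - x * p) / q) + 4 * (x / (2 * q)) =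
    2 * (n2 / q) + 4 * (n3 / q) + x / q - 4 * (x / q * p) by field.
  by lra.
- by rewrite -/q; field.
- rewrite -/q.
  have -> : q * ((n3 - x * p) / q + 2 * (x / (2 * q)) * (1 - p)) =
    n3 + x * (1 - 2 * p) by field.
  by rewrite -xE; ring.
- by rewrite -/q; field.
Qed.

Section color_small.
Context (R : realType) (d : measure_display) (T : measurableType d)
  (P : probability T R) (X : 'I_4 -> {RV P >-> R}) (theta : R).
Hypotheses (gX : centered_gaussian_vector X (covA theta))
  (s0 : 0 < sin theta) (c0 : 2^-1 <= cos theta).

(** With K = [normal_peak sigma] and s, c the sine and cosine, n3 >= G K / 2 and K <= 2s. Then n2 <=
    2K <= 4s explains 1/256. Further n1 - n3 <= 8 h s K, while (1 - 2p) n3 >= 2 h phi(1) G K / 2,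
    which explains the second condition. The bound h <= 1/4 keeps p >= 1/4. *)
Lemma color_process_small (h : R) (G := (1 - 2 * kappa 2^-1) * kappa 1 * expR (-1)) :
  sin theta <= 256^-1 -> 8 * sin theta <= phi 1 * G -> 0 < h -> h <= 4^-1 ->
  color_process P (threshold X h).
Proof.
move=> s1 s2 h0 h1; pose s := sin theta; pose c := cos theta.
have cp : 0 < c by rewrite /c; have := c0; lra.
have c1 : 2^-1 <= c by exact: c0.
have sp : 0 < s by exact: s0.
have sle : s <= 256^-1 by exact: s1.
pose p : R := kappa h.
have p2 : p < 2^-1 by exact: kappa_lt_half.
have /andP[] := kappa_diff (lexx 0) (ltW h0); rewrite subr0 kappa0 -/p => pl pu.
have f1 : phi 0 <= 1 :> R.
  by rewrite phiE expr0n oppr0 mul0r expR0 mulr1; exact: normal_peak1_le1.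
have p4 : 4^-1 <= p.
  by have := phi_gt0 (0 : R); move: (phi 0) f1 pu => f f1 pu f0; nra.
have f2 : phi 1 <= phi h :> R by apply: phi_le; [exact: ltW|lra].
have rp : 2 * h * phi 1 <= 1 - 2 * p.
  by move: (phi 1) (phi h) f2 pl => f f' f2 pl; nra.
pose sigma := c / s; have sg : 0 < sigma by exact: divr_gt0.
pose m := - h / s.
have m0 : m <= 0 by rewrite /m mulNr oppr_le0 divr_ge0// ltW.
pose K : R := normal_peak sigma.
have Kp : 0 < K by apply: normal_peak_gt0; rewrite gt_eqF.
have K2 : K <= 2 * s.
  rewrite /K normal_peak_scale// /sigma invf_div.
  have := normal_peak1_le1 R; have := normal_peak_ge0 (1 : R).
  move: (normal_peak 1) => k k0 k1.
  rewrite mulrAC ler_pdivrMr//; nra.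
(* In units of sigma the point 1 lies at distance (s + h) / c from the mean, small enough for the
   exponent to stay above -1. *)
have w1 : K * expR (-1) <= normal_pdf m sigma 1.
  rewrite normal_pdfE ?gt_eqF// /normal_fun -/K ler_pM2l// ler_expR.
  have -> : - (1 - m) ^+ 2 / (sigma ^+ 2 *+ 2) = - ((s + h) ^+ 2 / (2 * c ^+ 2)).
    by rewrite /m /sigma -(mulr_natl (_ ^+ 2)); field; rewrite !gt_eqF.
  rewrite lerN2 ler_pdivrMr; last by nra.
  nra.
pose n1 := orthant1 m sigma; pose n2 := orthant2 m sigma; pose n3 := orthant3 m sigma.
have k2 : kappa 2^-1 < 2^-1 :> R by apply: kappa_lt_half; rewrite invr_gt0.
have F0 : 0 <= (1 - 2 * kappa 2^-1) * kappa 1 :> R.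
  by rewrite mulr_ge0 ?kappa_ge0//; lra.
have n3G : 2^-1 * (G * K) <= n3.
  apply: (le_trans _ (orthant3_ge m0 sg)); rewrite ler_pM2l ?invr_gt0//.
  by rewrite /G -mulrA (mulrC (expR _)) ler_wpM2l.
have G0 : 0 <= G by rewrite /G mulr_ge0// expR_ge0.
have GK0 : 0 <= G * K := mulr_ge0 G0 (ltW Kp).
have n30 : 0 <= n3 by apply: le_trans n3G; rewrite mulr_ge0 ?invr_ge0.
have n31 : n3 <= n1 by exact: orthant3_le1.
have n32 : n3 <= n2 by exact: orthant3_le2.
have n2s : n2 <= 64^-1.
  by have := orthant2_le m sg; rewrite -/n2 -/K => n2K; lra.
have D : n1 - n3 <= (1 - 2 * p) * n3.
  have D1 := orthant1_sub3 m0 sg; apply: (le_trans D1); rewrite -/K.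
  have -> : 2 * - m / sigma ^+ 2 = 2 * h * s / c ^+ 2.
    by rewrite /m /sigma; field; rewrite !gt_eqF.
  have c2 : 2 * h * s / c ^+ 2 <= h * (8 * s).
    have c4 : 0 <= 8 * c ^+ 2 - 2 by nra.
    rewrite ler_pdivrMr ?exprn_gt0//.
    by have := mulr_ge0 (ltW (mulr_gt0 h0 sp)) c4; lra.
  apply: (@le_trans _ _ (K * (h * (phi 1 * G)))).
    apply: ler_wpM2l; first exact: ltW.
    by apply: (le_trans c2); rewrite ler_wpM2l// ltW.
  apply: (@le_trans _ _ (2 * h * phi 1 * (2^-1 * (G * K)))).
    by rewrite le_eqVlt; apply/orP; left; apply/eqP; field.
  apply: ler_pM => //; last by rewrite mulr_ge0 ?invr_ge0.
  by rewrite !mulr_ge0// ltW// phi_gt0.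
have [b [c' [e [[? ? ? ?] E3 E1 E2]]]] := color_weights_exist p4 p2 n30 n31 D n32 n2s.
exact: (@tetrahedron_color_process _ _ _ _ _ _ gX s0 cp h b c' e).
Qed.

End color_small.

(** * Absence of color representations at high levels *)

(** The density ratio is exp(- x) / t with x = u^2 (t^-2 - 1) / 2. Since exp x >= x, it is enough
    that t x >= 1/e, and u >= 1 allows this to be required of u in place of u^2. *)
Lemma normal_pdf_dominated (R : realType) (t e u : R) : 0 < t -> t < 1 -> 0 < e ->
  1 <= u -> 2 / ((t ^- 2 - 1) * t * e) <= u -> normal_pdf 0 t u <= e * phi u.
Proof.
move=> t0 t1 e0 u1 ue; have u0 : 0 < u by lra.
have tt0 : 0 < t ^+ 2 by exact: exprn_gt0.
pose dl := t ^- 2 - 1.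
have d0 : 0 < dl by rewrite subr_gt0 invf_gt1// expr_lt1// ltW.
rewrite normal_pdfE ?gt_eqF// /normal_fun subr0 normal_peak_scale// phiE.
have -> : - u ^+ 2 / (t ^+ 2 *+ 2) = - u ^+ 2 / 2 - u ^+ 2 * dl / 2.
  by rewrite /dl -(mulr_natl (_ ^+ 2)); field; rewrite gt_eqF.
rewrite expRD expRN.
set E := expR (- u ^+ 2 / 2); set x := u ^+ 2 * dl / 2.
have x0 : 0 < x by rewrite /x !mulr_gt0 ?exprn_gt0 ?invr_gt0.
have ex : x <= expR x by have := expR_ge1Dx x; lra.
have te : t^-1 * (expR x)^-1 <= e.
  rewrite -invfM invf_ple ?posrE ?mulr_gt0 ?expR_gt0//.
  apply: (@le_trans _ _ (t * x)); last by rewrite ler_pM2l.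
  have : 2 / ((t ^- 2 - 1) * t * e) <= u ^+ 2.
    by apply: (le_trans ue); rewrite expr2 ler_peMr// ltW.
  rewrite -/dl ler_pdivrMr ?mulr_gt0// => H.
  by rewrite -(ler_pM2r e0) mulVf ?gt_eqF// /x; lra.
have -> : t^-1 * normal_peak 1 * (E * (expR x)^-1) =
  (t^-1 * (expR x)^-1) * (normal_peak 1 * E) by ring.
by apply: ler_wpM2r => //; rewrite mulr_ge0 ?normal_peak_ge0 ?expR_ge0.
Qed.

Lemma normal_tail_dominated (R : realType) (t e : R) : 0 < t -> t < 1 -> 0 < e ->
  exists2 h0 : R, 0 < h0 & forall h, h0 < h ->
  (normal_prob 0 t `]h, +oo[ <= (e * kappa h)%:E)%E.
Proof.
move=> t0 t1 e0; exists (Num.max 1 (2 / ((t ^- 2 - 1) * t * e))).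
  by rewrite lt_max ltr01.
move=> h; rewrite gt_max => /andP[h1 h2].
rewrite EFinM -normal_prob_ccdfo /normal_prob -ge0_integralZl_EFin//; last 3 first.
- by move=> u _; rewrite lee_fin normal_pdf_ge0.
- by apply/measurable_EFinP; apply: measurable_funTS; exact: measurable_normal_pdf.
- exact: ltW.
apply: ge0_le_integral => //.
- by move=> u _; rewrite lee_fin normal_pdf_ge0.
- by apply/measurable_EFinP; apply: measurable_funTS; exact: measurable_normal_pdf.
- apply/measurable_EFinP; apply: measurable_funTS; apply: measurable_funM => //.
  exact: measurable_normal_pdf.
- move=> u /=; rewrite in_itv/= andbT => hu; rewrite -EFinM lee_fin.
  by apply: normal_pdf_dominated => //; lra.
Qed.

Section no_color.
Context (R : realType) (d : measure_display) (T : measurableType d)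
  (P : probability T R) (X : 'I_4 -> {RV P >-> R}) (theta : R).
Hypotheses (gX : centered_gaussian_vector X (covA theta))
  (s0 : 0 < sin theta) (c0 : 0 < cos theta).

(** If both coordinates exceed h, so does their average, a Gaussian of variance (1 + cos^2 theta) /
    2 < 1, whose tail is negligible against the standard one. *)
Lemma adjacent_tail (e : R) : 0 < e -> exists2 h0 : R, 0 < h0 & forall h, h0 < h ->
  (P [set w | (h < X o0 w)%R /\ (h < X o1 w)%R] <= (e * kappa h)%:E)%E.
Proof.
move=> e0; pose a (i : 'I_4) : R := nth 0 [:: 2^-1; 2^-1] i.
have [t [t0 t2 law _]] := gaussian_vector_law a gX.
have {t2}t2 : t ^+ 2 = (1 + cos theta ^+ 2) / 2.
  by rewrite t2 !big_ord4 !mxE /= /a/=; field.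
have c2 := sqr_ge0 (cos theta).
have tp : 0 < t by rewrite lt_neqAle t0 andbT eq_sym -sqrf_eq0 t2; apply/eqP; lra.
have t1 : t < 1.
  rewrite -(@ltr_pXn2r _ 2) ?nnegrE// expr1n t2.
  by have := cos2Dsin2 theta; have := exprn_gt0 2 s0; lra.
have [h0 h00 H] := normal_tail_dominated tp t1 e0.
exists h0 => // h /H; apply: le_trans.
have mgt i : measurable [set w | h < X i w].
  rewrite (_ : [set w | _] = X i @^-1` `]h, +oo[).
    by rewrite -[X in measurable X]setTI; apply: measurable_funPT.
  by apply/seteqP; split=> w /=; rewrite in_itv/= andbT.
have := law `]h, +oo[%classic (measurable_itv _).
rewrite /gaussian_law gt_eqF// => <-; apply: le_measure; rewrite ?inE.
- exact: measurableI (mgt o0) (mgt o1).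
- have mS : measurable_fun setT (fun w => \sum_i a i * X i w).
    by apply: measurable_sum => i; exact: measurable_funM.
  have := mS measurableT `]h, +oo[%classic (measurable_itv _).
  by rewrite setTI.
- by move=> w /= [h1 h2]; rewrite in_itv/= andbT big_ord4 /a/=; lra.
Qed.

Lemma no_color_process : exists2 h0 : R, 0 < h0 & forall h, h0 < h ->
  ~ color_process P (threshold X h).
Proof.
(* Let D be the probability that two given neighbours both exceed h. The marginal equation gives
   4(n1 - n3) = 4p - 8D + 4 n4, so D <= p/10 makes this at least 3.2p and contradicts the bound 2p.
   Any constant below 1/4 would do. *)
have [|h0 h00 H] := @adjacent_tail 10^-1; first by rewrite invr_gt0.
exists h0 => // h h1 [p [q [p01 rq Hq]]].
have h0' : 0 < h by lra.
have nuE : color_pmf p q = pattern_prob X h.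
  by apply/funext => y; apply: EFin_inj; rewrite -Hq pattern_probE.
have [] := color_pmf_obstruction p rq.
rewrite nuE (weighted_ones_pattern_prob gX s0 c0) => pE.
have {pE} pE : p = kappa h by lra.
have k0 : 0 < kappa h by exact: kappa_gt0 (ltW h0').
have k1 := kappa_lt_half h0'.
have k01 : 0 < kappa h < 1 by apply/andP; split; lra.
rewrite pE (odd_imbalance_pattern_prob gX s0 c0).
move=> /(_ k01 (pattern_prob_1010 gX s0 c0 h)).
have := H h h1; rewrite (pattern_prob_adjacent gX s0 c0) lee_fin.
have := pattern_prob_marginal gX s0 c0 h.
have := pattern_prob_ge0 X h (pat true true true true).
lra.
Qed.

End no_color.

Theorem theorem4p8 (R : realType) (d : R -> measure_display)
    (T : forall theta : R, measurableType (d theta))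
    (P : forall theta : R, probability (T theta) R)
    (X : forall theta : R, 'I_4 -> {RV (P theta) >-> R})
    (hX : forall theta : R, 0 < theta <= pi / 2 ->
       centered_gaussian_vector (X theta) (covA theta)) :
  [/\ forall theta : R, 0 < theta <= pi / 4 ->
        color_process (P theta) (threshold (X theta) 0),
      exists2 theta0 : R, 0 < theta0 &
        forall theta : R, 0 < theta < theta0 ->
        exists2 htheta : R, 0 < htheta &
        forall h : R, 0 < h < htheta ->
          color_process (P theta) (threshold (X theta) h)
    & forall theta : R, 0 < theta < pi / 4 ->
        exists2 htheta : R, 0 < htheta &
        forall h : R, htheta < h ->
          ~ color_process (P theta) (threshold (X theta) h)].
Proof.
have gX theta : 0 < theta <= pi / 4 -> centered_gaussian_vector (X theta) (covA theta).
  move=> /andP[t0 t1]; apply: hX; rewrite t0 (le_trans t1)//.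
  by have := pi_gt0 R; lra.
split=> [theta ht||theta /andP[t0 /ltW t1]].
- have [s0 c0 sc] := first_octant ht.
  exact: color_process_median (gX _ ht) s0 c0 sc.
- pose G : R := (1 - 2 * kappa 2^-1) * kappa 1 * expR (-1).
  have G0 : 0 < phi 1 * G.
    have k2 : kappa 2^-1 < 2^-1 :> R by apply: kappa_lt_half; rewrite invr_gt0.
    have k1 : 0 < 1 - 2 * kappa 2^-1 :> R by lra.
    rewrite mulr_gt0 ?phi_gt0// mulr_gt0 ?expR_gt0// mulr_gt0//.
    exact: kappa_gt0 ler01.
  (* The last two bounds pass from theta to sin theta by sin theta <= theta; the level bound 1/4
     below does not depend on theta. *)
  exists (Num.min (pi / 4) (Num.min 256^-1 (phi 1 * G / 8))).
    by rewrite !lt_min divr_gt0 ?pi_gt0//= invr_gt0 ltr0n/= divr_gt0.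
  move=> theta /andP[t0]; rewrite !lt_min => /and3P[t1 t2 t3].
  have ht : 0 < theta <= pi / 4 by rewrite t0 ltW.
  have [s0 c0 _] := first_octant ht; have st := sin_le_id (ltW t0).
  exists 4^-1 => [|h /andP[h0 h1]]; first by rewrite invr_gt0.
  have c1 : 2^-1 <= cos theta.
    rewrite -(@ler_pXn2r _ 2) ?nnegrE ?invr_ge0 ?(ltW c0)//.
    by have := cos2Dsin2 theta; nra.
  by apply: (color_process_small (gX _ ht) s0 c1 _ _ h0 (ltW h1)); rewrite -/G; lra.
- have ht : 0 < theta <= pi / 4 by rewrite t0.
  have [s0 c0 _] := first_octant ht.
  have [h0 h00 H] := no_color_process (gX _ ht) s0 c0.
  by exists h0.
Qed.
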